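(* Let $G$ be a metric graph and $p\ge1$ an integer. The variogram $\gamma_p$ is invariant under reordering of the vertices of $G$, under reorientation of the edges of $G$, and under splitting or merging edges via vertices of degree $2$. (Splitting: if $G'$ is obtained from $G$ by declaring an interior point $s$ of an edge $e$ to be a new vertex of degree $2$, thus replacing $e$ with two edges $e_1,e_2$ with $l_{e_1}+l_{e_2}=l_e$, then, identifying the points of $G$ and $G'$, $\gamma_{p,G}(x_1,x_2)=\gamma_{p,G'}(x_1,x_2)$ for all $x_1,x_2$; merging is the inverse operation.) In particular, $\gamma_p$ and $d_p=\sqrt{\gamma_p}$ are intrinsic properties of the graph topology, i.e. they do not depend on the chosen representation of the metric graph.
   Context: A metric graph $G=(V,E)$ has a finite vertex set $V$ ($n:=|V|$) and a finite edge set $E$; each edge $e\in E$ has a length $0<l_e<\infty$ and is identified (after choosing an orientation) with the segment $[0,l_e]$, edges being glued at their common endpoints (the vertices). $G$ also denotes the set of all points on the edges (vertices included). Throughout, $G$ is connected and simple (no self-loops, no multiple edges). For $f:G\to\mathbb R$, $f_e$ is the restriction of $f$ to $e$ viewed as a function on $[0,l_e]$, and $\int_G f(x)\,dx:=\sum_{e\in E}\int_0^{l_e}f_e(x)\,dx$. For $v\in V$, $E_v$ is the set of edges incident to $v$. The exiting directional derivative is $\partial_e f(v):=\lim_{h\to0^+}\frac{f(v+he)-f(v)}{h}$, where $v+he$ is the point of $e$ at shortest-path distance $h$ from $v$; $\partial_e^i$ is the $i$-th order exiting derivative. $f\in C^m(G)$ means: $f|_e\in C^m(e)$ for each $e\in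 E$, and at each $v\in V$ the Kirchhoff conditions of every order $i\in\{0,\dots,m\}$ hold: if $i$ is even, all exiting derivatives $\partial_e^i f(v)$, $e\in E_v$, are equal; if $i$ is odd, $\sum_{e\in E_v}\partial_e^i f(v)=0$. For an integer $p\ge1$ let $m:=p-1$. Let $\mathcal F$ be the set of $f:G\to\mathbb R$ such that $f\in C^m(G)$; for each $e\in E$, $f_e^{(m)}$ is absolutely continuous and $f_e^{(m+1)}\in L^2([0,l_e])$; and $\sum_{v\in V}f(v)=0$. Put $\langle f,g\rangle_{\mathcal F}:=\int_G f^{(p)}(x)g^{(p)}(x)\,dx$. Then $\mathcal H=(\mathcal F,\langle\cdot,\cdot\rangle_{\mathcal F})$ is a reproducing kernel Hilbert space (RKHS). $Z=Z_m$ is the (unique in law) zero-mean Gaussian process on $G$ whose RKHS is $\mathcal H$ (i.e. its covariance function is the reproducing kernel of $\mathcal H$), and $\gamma_p(x_1,x_2)=\gamma_{p,G}(x_1,x_2):=\mathrm{Var}(Z(x_1)-Z(x_2))$ is its variogram. *)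

(* Defs.v *)
From HB Require Import structures.
From mathcomp Require Import all_boot all_order all_algebra all_fingroup.
From mathcomp Require Import all_classical all_reals all_analysis.
Set Implicit Arguments.
Unset Strict Implicit.
Unset Printing Implicit Defensive.
Import Order.TTheory GRing.Theory Num.Theory.
Import numFieldNormedType.Exports.
Local Open Scope classical_set_scope.
Local Open Scope ring_scope.

Definition adj (V E : finType) (src tgt : E -> V) : rel V :=
  fun u v => [exists e, [set src e; tgt e]%SET == [set u; v]%SET].

(* The record stores a representation of a metric graph: the numbering of the
   vertices and the orientation (from [src] to [tgt]) of the edges are data. *)
Record mgraph (R : realType) := MGraph {
  nv : nat;
  edge : finType;
  src : edge -> 'I_nv;
  tgt : edge -> 'I_nv;
  len : edge -> R;
  nv_gt0 : (0 < nv)%N;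
  len_gt0 : forall e, 0 < len e;
  no_loop : forall e, src e != tgt e;
  no_multi : forall e e',
    [set src e; tgt e]%SET = [set src e'; tgt e']%SET -> e = e';
  connected_mgraph : forall u v, connect (adj src tgt) u v }.

Section Points.
Context {R : realType} (G : mgraph R).

(* A point is a vertex, or a pair (e, t) with t in the open segment ]0, len e[. *)
Definition gpoint : Type :=
  ('I_(nv G) + {et : edge G * R | 0 < et.2 < len et.1})%type.

Definition pt (e : edge G) (t : R) : gpoint :=
  if insub (e, t) is Some u then inr u
  else if t <= 0 then inl (src e) else inl (tgt e).

Definition incident (v : 'I_(nv G)) (e : edge G) : bool :=
  (src e == v) || (tgt e == v).

(* The point v + h e. *)
Definition exit_pt (e : edge G) (v : 'I_(nv G)) (h : R) : gpoint :=
  if src e == v then pt e h else pt e (len e - h).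

End Points.

Section ConnectLemmas.

Lemma connect_homo (V V' : finType) (r : rel V) (r' : rel V') (f : V -> V') :
  (forall u v, r u v -> connect r' (f u) (f v)) ->
  forall u v, connect r u v -> connect r' (f u) (f v).
Proof.
move=> H u v /connectP[q + ->]; elim: q u => [|w q IH] u /=.
  by move=> _; exact: connect0.
by case/andP=> /H uw /IH; exact: connect_trans.
Qed.

Lemma adj_sym (V E : finType) (src tgt : E -> V) : symmetric (adj src tgt).
Proof. by move=> u v; rewrite /adj finset.setUC. Qed.

Lemma adj_edge (V E : finType) (src tgt : E -> V) e :
  adj src tgt (src e) (tgt e).
Proof. by apply/existsP; exists e. Qed.

Lemma set2P_inj (V : finType) (a b c d : V) :
  [set a; b]%SET = [set c; d]%SET -> (a = c /\ b = d) \/ (a = d /\ b = c).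
Proof.
move=> /setP H; move: (H a) (H b) (H c) (H d).
rewrite !inE !eqxx ?orbT /=.
move=> /esym/orP[]/eqP-> /esym/orP[]/eqP->; rewrite ?eqxx ?orbT //=.
- by rewrite orbb => _ /eqP ->; left.
- by left.
- by right.
- by rewrite orbb => /eqP -> _; left.
Qed.

Lemma connect_adj_homo (V V' E E' : finType) (s t : E -> V) (s' t' : E' -> V')
    (f : V -> V') :
  (forall e, connect (adj s' t') (f (s e)) (f (t e))) ->
  forall u v, connect (adj s t) u v -> connect (adj s' t') (f u) (f v).
Proof.
move=> H; apply: connect_homo => u v /existsP[e /eqP/set2P_inj].
have sym := sym_connect_sym (@adj_sym _ _ s' t').
by case=> -[<- <-] //; rewrite sym.
Qed.

End ConnectLemmas.

Section Reorder.
Context {R : realType} (G : mgraph R) (s : 'S_(nv G)).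

Let src' e := s (@src R G e).
Let tgt' e := s (@tgt R G e).

Fact reorder_no_loop e : src' e != tgt' e.
Proof. by rewrite (inj_eq perm_inj) no_loop. Qed.

Fact reorder_no_multi e e' :
  [set src' e; tgt' e]%SET = [set src' e'; tgt' e']%SET -> e = e'.
Proof.
move=> /set2P_inj H; apply: no_multi.
by case: H => -[/perm_inj -> /perm_inj ->] //; rewrite finset.setUC.
Qed.

Fact reorder_connected u v : connect (adj src' tgt') u v.
Proof.
rewrite -(permKV s u) -(permKV s v).
apply: (@connect_adj_homo _ _ _ _ (@src R G) (@tgt R G) _ _ s);
  last exact: connected_mgraph.
by move=> e; apply/connect1/adj_edge.
Qed.

Definition reorder : mgraph R :=
  MGraph (nv_gt0 G) (@len_gt0 R G) reorder_no_loop reorder_no_multi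
    reorder_connected.

Definition reorder_pt (x : gpoint G) : gpoint reorder :=
  match x with inl v => inl (s v) | inr u => inr u end.

End Reorder.

Section Relabel.
Context {R : realType} (G : mgraph R) (E : finType) (h : E -> edge G)
  (hbij : bijective h).

Let src' e := src (h e).
Let tgt' e := tgt (h e).

Fact relabel_no_multi e e' :
  [set src' e; tgt' e]%SET = [set src' e'; tgt' e']%SET -> e = e'.
Proof. by move=> /no_multi/(bij_inj hbij). Qed.

Fact relabel_connected u v : connect (adj src' tgt') u v.
Proof.
apply: (@connect_adj_homo _ _ _ _ (@src R G) (@tgt R G) _ _ id);
  last exact: connected_mgraph.
by case: hbij => g _ gK e; rewrite -(gK e); apply/connect1/adj_edge.
Qed.

Definition relabel : mgraph R :=
  MGraph (nv_gt0 G) (fun e => len_gt0 (h e)) (fun e => no_loop (h e))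
    relabel_no_multi relabel_connected.

Definition relabel_pt (x : gpoint relabel) : gpoint G :=
  match x with inl v => inl v | inr u => pt (h (val u).1) (val u).2 end.

End Relabel.

Section Reorient.
Context {R : realType} (G : mgraph R) (flip : pred (edge G)).

Let src' e := if flip e then @tgt R G e else src e.
Let tgt' e := if flip e then @src R G e else tgt e.

Fact reorient_no_loop e : src' e != tgt' e.
Proof.
by rewrite /src' /tgt'; case: (flip e); rewrite ?no_loop // eq_sym no_loop.
Qed.

Fact reorient_no_multi e e' :
  [set src' e; tgt' e]%SET = [set src' e'; tgt' e']%SET -> e = e'.
Proof.
have E a : [set src' a; tgt' a]%SET = [set src a; tgt a]%SET.
  by rewrite /src' /tgt'; case: (flip a) => //; rewrite finset.setUC.
by rewrite !E => /no_multi.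
Qed.

Fact reorient_connected u v : connect (adj src' tgt') u v.
Proof.
apply: (@connect_adj_homo _ _ _ _ (@src R G) (@tgt R G) _ _ id);
  last exact: connected_mgraph.
move=> e; have := adj_edge src' tgt' e.
by rewrite /src' /tgt'; case: (flip e) => H; apply: connect1; rewrite // adj_sym.
Qed.

Definition reorient : mgraph R :=
  MGraph (nv_gt0 G) (@len_gt0 R G) reorient_no_loop reorient_no_multi
    reorient_connected.

Definition reorient_pt (x : gpoint G) : gpoint reorient :=
  match x with
  | inl v => inl v
  | inr u => let: (e, t) := val u in
             @pt R reorient e (if flip e then len e - t else t)
  end.

End Reorient.

(* The new vertex s is numbered last.  The edge e is replaced with
   [Some e], running from [src e] to s, and [None], running from s to [tgt e]. *)
Section Split.
Context {R : realType} (G : mgraph R) (e0 : edge G) (s : R)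
  (hs : 0 < s < len e0).

Let old (v : 'I_(nv G)) : 'I_(nv G).+1 := widen_ord (leqnSn _) v.

Definition split_src (e : option (edge G)) : 'I_(nv G).+1 :=
  if e is Some e then old (src e) else ord_max.
Definition split_tgt (e : option (edge G)) : 'I_(nv G).+1 :=
  if e is Some e then (if e == e0 then ord_max else old (tgt e))
  else old (tgt e0).
Definition split_len (e : option (edge G)) : R :=
  if e is Some e then (if e == e0 then s else len e) else len e0 - s.

Let old_inj : injective old.
Proof. by move=> u v /(congr1 val) /= /val_inj. Qed.

Let old_max v : (old v == ord_max) = false.
Proof. by apply/negbTE; rewrite -val_eqE /= neq_ltn ltn_ord. Qed.

Let max_old v : (ord_max == old v) = false.
Proof. by rewrite eq_sym old_max. Qed.

Fact split_len_gt0 e : 0 < split_len e.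
Proof.
case/andP: hs => s0 sl; case: e => [e|] /=; last by rewrite subr_gt0.
by case: eqP => // _; exact: len_gt0.
Qed.

Fact split_no_loop e : split_src e != split_tgt e.
Proof.
case: e => [e|] /=; last by rewrite max_old.
case: (e =P e0) => _; first by rewrite old_max.
by rewrite (inj_eq old_inj) no_loop.
Qed.

Fact split_no_multi e e' :
  [set split_src e; split_tgt e]%SET = [set split_src e'; split_tgt e']%SET ->
  e = e'.
Proof.
have oM u : old u = ord_max -> False by move/eqP; rewrite old_max.
have Mo u : ord_max = old u -> False by move/eqP; rewrite max_old.
have nl (e1 : edge G) : src e1 = tgt e1 -> False.
  by move/eqP; rewrite (negbTE (no_loop e1)).
move=> /set2P_inj.
case: e e' => [e|] [e'|] //=.
- case: (e =P e0) => [->|ne]; case: (e' =P e0) => [->|ne'] //.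
  + by case=> -[] => [_ /Mo|_ /Mo].
  + by case=> -[] => [_ /oM|/oM].
  + move=> H; congr Some; apply: no_multi.
    by case: H => -[/old_inj -> /old_inj ->] //; rewrite finset.setUC.
- case: (e =P e0) => [->|ne]; first by case=> -[] => [/oM|/old_inj/nl].
  by case=> -[] => [/oM|_ /oM].
- case: (e' =P e0) => [->|ne']; first by case=> -[] => [/Mo|_ /old_inj/esym/nl].
  by case=> -[] => [/Mo|/Mo].
Qed.

Fact split_connected u v : connect (adj split_src split_tgt) u v.
Proof.
have sym := sym_connect_sym (@adj_sym _ _ split_src split_tgt).
have c1 : connect (adj split_src split_tgt) (old (src e0)) ord_max.
  have := adj_edge split_src split_tgt (Some e0).
  by rewrite /= eqxx; exact: connect1.
have c2 : connect (adj split_src split_tgt) ord_max (old (tgt e0)).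
  exact: connect1 (adj_edge split_src split_tgt None).
have cold a b : connect (adj split_src split_tgt) (old a) (old b).
  apply: (@connect_adj_homo _ _ _ _ (@src R G) (@tgt R G) _ _ old);
    last exact: connected_mgraph.
  move=> e; have [->|ne] := eqVneq e e0; first exact: connect_trans c1 c2.
  have := adj_edge split_src split_tgt (Some e).
  by rewrite /= (negbTE ne); exact: connect1.
have cmax a : connect (adj split_src split_tgt) a ord_max.
  have [j ->|->] := unliftP ord_max a; last exact: connect0.
  have -> : lift ord_max j = old j by apply: val_inj; exact: lift_max.
  exact: connect_trans (cold j (src e0)) c1.
by apply: connect_trans (cmax u) _; rewrite sym.
Qed.

Definition split_edge : mgraph R :=
  MGraph (ltn0Sn _) split_len_gt0 split_no_loop split_no_multi split_connected.

Definition split_pt (x : gpoint G) : gpoint split_edge :=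
  match x with
  | inl v => inl (old v)
  | inr u => let: (e, t) := val u in
             if (e == e0) && (s < t) then @pt R split_edge None (t - s)
             else @pt R split_edge (Some e) t
  end.

Definition merge_pt (y : gpoint split_edge) : gpoint G :=
  match y with
  | inl v => if unlift ord_max v is Some w then inl w else pt e0 s
  | inr u => match val u with
             | (Some e, t) => pt e t
             | (None, t) => pt e0 (s + t)
             end
  end.

End Split.

(* [@same_mgraph R G G' phi]: G and G' represent the same metric graph, and phi
   identifies their points.  Merging is the case [same_sym] of [same_split];
   [same_relabel] accounts for the names of the edges, which only exist in our
   encoding (in a simple graph, an edge is determined by its endpoints). *)
Inductive same_mgraph {R : realType} :
    forall G G' : mgraph R, (gpoint G -> gpoint G') -> Prop :=
| same_refl G : @same_mgraph R G G id
| same_sym G G' (phi : gpoint G -> gpoint G') (psi : gpoint G' -> gpoint G) :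
    same_mgraph phi -> cancel phi psi -> cancel psi phi -> same_mgraph psi
| same_trans G1 G2 G3 (phi : gpoint G1 -> gpoint G2) (psi : gpoint G2 -> gpoint G3) :
    same_mgraph phi -> same_mgraph psi -> same_mgraph (psi \o phi)
| same_reorder G (s : 'S_(nv G)) : same_mgraph (@reorder_pt R G s)
| same_relabel G (E : finType) (h : E -> edge G) (hbij : bijective h) :
    same_mgraph (@relabel_pt R G E h hbij)
| same_reorient G (flip : pred (edge G)) :
    same_mgraph (@reorient_pt R G flip)
| same_split G (e : edge G) (s : R) (hs : 0 < s < len e) :
    same_mgraph (@split_pt R G e s hs).

Section Segment.
Context {R : realType} (l : R).

(* Derivatives are relative to [0, l], hence one-sided at 0 and at l. *)
Definition is_deriv_on (g : R -> R) (x d : R) : Prop :=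
  (fun y => (g y - g x) / (y - x)) @ within `[0, l] x^' --> d.

(* The limit is a default value at the points where there is no derivative. *)
Definition deriv_on (g : R -> R) (x : R) : R :=
  lim ((fun y => (g y - g x) / (y - x)) @ within `[0, l] x^').

Definition derivn_on (i : nat) (g : R -> R) : R -> R := iter i deriv_on g.

Definition Cm_on (m : nat) (g : R -> R) : Prop :=
  (forall i, (i < m)%N -> forall x, x \in `[0, l] ->
     exists d, is_deriv_on (derivn_on i g) x d) /\
  (forall i, (i <= m)%N -> {within `[0, l], continuous (derivn_on i g)}).

Definition abs_continuous_on (g : R -> R) : Prop :=
  forall eps : R, 0 < eps -> exists2 delta : R, 0 < delta &
  forall (k : nat) (a b : 'I_k -> R),
    (forall i, 0 <= a i /\ a i <= b i /\ b i <= l) ->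
    (forall i j, i != j -> b i <= a j \/ b j <= a i) ->
    \sum_(i < k) (b i - a i) < delta ->
    \sum_(i < k) `|g (b i) - g (a i)| < eps.

(* The derivative of g, which is only defined almost everywhere, is in
   L^2([0, l]). *)
Definition deriv_in_L2 (g : R -> R) : Prop :=
  exists h : R -> R, [/\ measurable_fun `[0, l] h,
    (\int[lebesgue_measure]_(x in `[0%R, l]) ((h x) ^+ 2)%:E < +oo)%E &
    {ae lebesgue_measure, forall x : R, x \in `[0, l] -> is_deriv_on g x (h x)}].

End Segment.

Section Space.
Context {R : realType} (p : nat) (G : mgraph R).
Implicit Types f g : gpoint G -> R.

Definition on_edge f (e : edge G) : R -> R := fun t => f (pt e t).

Definition exit_deriv (i : nat) f (e : edge G) (v : 'I_(nv G)) : R :=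
  derivn_on (len e) i (fun h => f (exit_pt e v h)) 0.

Definition kirchhoff (i : nat) f (v : 'I_(nv G)) : Prop :=
  if odd i then \sum_(e | incident v e) exit_deriv i f e v = 0
  else forall e e', incident v e -> incident v e' ->
         exit_deriv i f e v = exit_deriv i f e' v.

Definition Cm_graph (m : nat) f : Prop :=
  (forall e, Cm_on (len e) m (on_edge f e)) /\
  (forall v i, (i <= m)%N -> kirchhoff i f v).

Definition in_F f : Prop :=
  [/\ Cm_graph p.-1 f,
      forall e, abs_continuous_on (len e) (derivn_on (len e) p.-1 (on_edge f e)),
      forall e, deriv_in_L2 (len e) (derivn_on (len e) p.-1 (on_edge f e)) &
      \sum_v f (inl v) = 0].

Definition innerF f g : R :=
  \sum_e \int[lebesgue_measure]_(t in `[0, len e])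
    (derivn_on (len e) p (on_edge f e) t * derivn_on (len e) p (on_edge g e) t).

Definition reproducing_kernel (k : gpoint G -> gpoint G -> R) : Prop :=
  forall x, in_F (k x) /\ forall f, in_F f -> innerF f (k x) = f x.

End Space.

Section Gaussian.
Context {R : realType} {d : measure_display} {T : measurableType d}
  (P : probability T R).

(* Point masses are degenerate Gaussian laws ([normal_prob m 0] is not). *)
Definition gaussian (X : T -> R) : Prop :=
  exists m : R,
    (forall A : set R, measurable A -> pushforward P X A = \d_m A) \/
    (exists2 s : R, 0 < s &
       forall A : set R, measurable A -> pushforward P X A = normal_prob m s A).

Definition gaussian_process {I : Type} (Z : I -> {RV P >-> R}) : Prop :=
  forall (k : nat) (a : 'I_k -> R) (x : 'I_k -> I),
    gaussian (fun w => \sum_(j < k) a j * Z (x j) w).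

End Gaussian.

Section Variogram.
Context {R : realType} (p : nat) (G : mgraph R).

(* Z is a version of the process Z_m, m = p - 1. *)
Definition is_Zm d (T : measurableType d) (P : probability T R)
    (Z : gpoint G -> {RV P >-> R}) : Prop :=
  [/\ gaussian_process Z,
      forall x, ('E_P[Z x] = 0)%E &
      exists2 k, reproducing_kernel p k &
        forall x y, covariance P (Z x) (Z y) = (k x y)%:E].

Definition is_variogram (gam : gpoint G -> gpoint G -> R) : Prop :=
  exists (d : measure_display) (T : measurableType d) (P : probability T R)
    (Z : gpoint G -> {RV P >-> R}),
    is_Zm Z /\ forall x1 x2, 'V_P[Z x1 \- Z x2] = (gam x1 x2)%:E.

Lemma reproducing_kernel_unique (k1 k2 : gpoint G -> gpoint G -> R) :
  reproducing_kernel p k1 -> reproducing_kernel p k2 -> k1 = k2.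
Proof.
have key (k k' : gpoint G -> gpoint G -> R) : reproducing_kernel p k ->
    reproducing_kernel p k' -> forall x y, k x y = k' y x.
  move=> h h' x y.
  have <- := proj2 (h' y) (k x) (proj1 (h x)).
  have <- := proj2 (h x) (k' y) (proj1 (h' y)).
  rewrite /innerF; apply: eq_bigr => e _; apply: eq_Rintegral => t _.
  by rewrite mulrC.
move=> h h'; apply/funext => x; apply/funext => y.
by rewrite (key _ _ h h) (key _ _ h h').
Qed.

Let Zm_L2 d (T : measurableType d) (P : probability T R) (X : {RV P >-> R}) r :
  ('E_P[X] = 0)%E -> covariance P X X = r%:E -> (X : T -> R) \in Lfun P 2%:E.
Proof.
move=> EX; rewrite covariance.unlock EX /= expectation.unlock => H.
rewrite inE; apply/andP; split; rewrite inE //=.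
rewrite /finite_norm unlock /=; apply: poweR_lty.
rewrite (_ : integral _ _ _ = r%:E) ?ltry // -H; apply: eq_integral => x _ /=.
by rewrite powR_mulrn// real_normK ?num_real// !fctE/= subr0 expr2.
Qed.

Lemma is_variogramE (gam k : gpoint G -> gpoint G -> R) :
  reproducing_kernel p k -> is_variogram gam ->
  gam = fun x y => k x x + k y y - 2 * k x y.
Proof.
move=> kP [d [T [P [Z [[gZ EZ [k' kP' cov]] V]]]]].
rewrite (reproducing_kernel_unique kP kP').
apply/funext => x; apply/funext => y; apply: EFin_inj; rewrite -V.
rewrite varianceB; try exact: Zm_L2 (EZ _) (cov _ _).
by rewrite /variance !cov.
Qed.

Lemma is_variogram_unique (g g' : gpoint G -> gpoint G -> R) :
  is_variogram g -> is_variogram g' -> g = g'.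
Proof.
move=> gP g'P; case: (gP) => d [T [P [Z [[_ _ [k kP _]] _]]]].
by rewrite (is_variogramE kP gP) (is_variogramE kP g'P).
Qed.

(* The unique variogram, by [is_variogram_unique]; the default value 0 of
   [xget] is never meant to be used, since the process Z_m exists. *)
Definition variogram : gpoint G -> gpoint G -> R :=
  xget (fun _ _ => 0) [set gam | is_variogram gam].

Definition variogram_dist (x1 x2 : gpoint G) : R := Num.sqrt (variogram x1 x2).

End Variogram.

(* Main.v *)
(* Reordering, relabelling and reorienting are isomorphisms of metric graphs.
   Splitting an edge at s identifies the spaces of functions satisfying the
   smoothness and Kirchhoff conditions: at the new vertex of degree 2, the
   Kirchhoff conditions of order i <= p - 1 say exactly that the left and right
   derivatives of order i agree, i.e. that the two pieces glue to a function of
   the same Sobolev class.  The seminorm <f, f> is the same on both sides; only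
   the normalization [\sum_v f v = 0] changes.  Since constants are in the kernel
   of the seminorm, the process of the split graph is Z - b Z(s) for a constant b,
   and b Z(s) cancels out in Var(Z(x1) - Z(x2)). *)
From HB Require Import structures.
Require Import Defs.
From mathcomp Require Import all_boot all_order all_algebra all_fingroup.
From mathcomp Require Import all_classical all_reals all_analysis.
From mathcomp Require Import measurable_realfun.
From mathcomp Require Import lra ring.
Set Implicit Arguments.
Unset Strict Implicit.
Unset Printing Implicit Defensive.
Import Order.TTheory GRing.Theory Num.Theory.
Import numFieldNormedType.Exports.
Local Open Scope classical_set_scope.
Local Open Scope ring_scope.

(** * Derivatives relative to a segment *)

(** The obstacle is that [deriv_on] is a [lim], with a default value where no derivative exists, and
    that the derivative of order p in [innerF] exists only almost everywhere. Hence the analysis is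
    done on explicit families of derivatives over arbitrary segments, and [derivn_on] is met only
    when passing to and from functions on the graph. All the invariances are one transfer along a
    bijection of points under which the sums over vertices differ by [b] times the value at a point
    [z]: [b = 0] for isomorphisms, [b = 1] and [z] the new vertex for splitting. If n' counts the
    vertices of the split graph, the multiple of Z(s) to subtract is 1 / n', because the correction
    is repeated at n' vertices and must cancel the one extra value Z(s). Existence of the process is
    not established here, so the transfer is made in both directions: a graph without variogram
    corresponds to another one without, and both get the default value of [xget]. *)

Section SegmentDerivative.
Context {R : realType}.
Implicit Types (a b c x d k ep : R) (g : R -> R).

(** The segment need not start at 0: the second half of a split edge lives on [s, len e0] before it
    is shifted to the origin. *)
Definition is_deriv_seg a b g x d : Prop :=
  (fun y => (g y - g x) / (y - x)) @ within `[a, b] x^' --> d.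

Lemma is_deriv_segP a b g x d :
  is_deriv_seg a b g x d <->
  forall e, 0 < e -> exists2 delta, 0 < delta & forall y, a <= y <= b ->
    y != x -> `|x - y| < delta -> `|d - (g y - g x) / (y - x)| < e.
Proof.
split=> [/cvgrPdist_lt H e e0|H].
  have := H _ e0; rewrite near_withinE => /nbhs_ballP[r /= r0 Hr].
  exists r => // y yab yx xy; apply: (Hr y xy yx).
  by rewrite /= in_itv.
apply/cvgrPdist_lt => e /H[r r0 Hr].
rewrite near_withinE; apply/nbhs_ballP; exists r => //= y xy yx.
by rewrite in_itv /= => yab; exact: Hr.
Qed.

(** A nondegenerate segment accumulates at each of its points, which makes limits along this filter
    unique. *)
Lemma is_deriv_seg_proper a b x : a < b -> a <= x <= b ->
  ProperFilter (within `[a, b] x^').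
Proof.
move=> ab /andP[ax xb]; split=> [H|]; last exact: within_filter.
have /nbhs_ballP[r /= r0 Hr] :
    nbhs x (fun y => y != x -> `[a, b]%classic y -> False) by exact: H.
have [axE|xa] := eqVneq a x.
  pose t := Num.min (r / 2) (b - x).
  have t0 : 0 < t by rewrite lt_min divr_gt0// subr_gt0 -axE ab.
  have tr : t < r.
    by rewrite gt_min ltr_pdivrMr // ltr_pMr // ltr1n.
  have tb : t <= b - x by rewrite ge_min lexx orbT.
  apply: (Hr (x + t)).
  - by rewrite /ball /= opprD addrA subrr sub0r normrN gtr0_norm.
  - by rewrite -subr_eq0 addrAC subrr add0r gt_eqF.
  - by rewrite /= in_itv /=; apply/andP; split; lra.
have {ax} ax : a < x by rewrite lt_neqAle xa.
pose t := Num.min (r / 2) (x - a).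
have t0 : 0 < t by rewrite lt_min divr_gt0// subr_gt0.
have tr : t < r.
  by rewrite gt_min ltr_pdivrMr // ltr_pMr // ltr1n.
have tb : t <= x - a by rewrite ge_min lexx orbT.
apply: (Hr (x - t)).
- by rewrite /ball /= opprB addrCA subrr addr0 gtr0_norm.
- by rewrite -subr_eq0 addrAC subrr add0r oppr_eq0 gt_eqF.
- by rewrite /= in_itv /=; apply/andP; split; lra.
Qed.

Lemma is_deriv_seg_unique a b g x d : a < b -> a <= x <= b ->
  is_deriv_seg a b g x d ->
  lim ((fun y => (g y - g x) / (y - x)) @ within `[a, b] x^') = d.
Proof.
by move=> ab xab; have := is_deriv_seg_proper ab xab => FF; exact: cvg_lim.
Qed.

Lemma eq_is_deriv_seg a b g g' x d : a <= x <= b ->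
  (forall y, a <= y <= b -> g y = g' y) ->
  is_deriv_seg a b g x d -> is_deriv_seg a b g' x d.
Proof.
move=> xab E /is_deriv_segP H; apply/is_deriv_segP => e /H[r r0 Hr].
by exists r => // y yab; rewrite -!E //; exact: Hr.
Qed.

Lemma is_deriv_seg_sub a b a' b' g x d : a <= a' -> b' <= b ->
  is_deriv_seg a b g x d -> is_deriv_seg a' b' g x d.
Proof.
move=> aa bb /is_deriv_segP H; apply/is_deriv_segP => e /H[r r0 Hr].
by exists r => // y /andP[ay yb]; apply: Hr; lra.
Qed.

Lemma is_deriv_seg_cat a c b g x d :
  is_deriv_seg a c g x d -> is_deriv_seg c b g x d -> is_deriv_seg a b g x d.
Proof.
move=> /is_deriv_segP H1 /is_deriv_segP H2; apply/is_deriv_segP => e e0.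
have [r1 r10 {}H1] := H1 _ e0; have [r2 r20 {}H2] := H2 _ e0.
exists (Num.min r1 r2); first by rewrite lt_min r10.
move=> y yab yx; rewrite lt_min => /andP[y1 y2].
by have [yc|cy] := leP y c; [apply: H1|apply: H2] => //; lra.
Qed.

Lemma is_deriv_seg_left a c b g x d : x < c ->
  is_deriv_seg a c g x d -> is_deriv_seg a b g x d.
Proof.
move=> xc /is_deriv_segP H; apply/is_deriv_segP => e /H[r r0 Hr].
exists (Num.min r (c - x)); first by rewrite lt_min r0 subr_gt0.
move=> y yab yx; rewrite lt_min => /andP[yr]; rewrite distrC => yc.
by apply: Hr => //; have := ler_norm (y - x); lra.
Qed.

Lemma is_deriv_seg_right a c b g x d : c < x ->
  is_deriv_seg c b g x d -> is_deriv_seg a b g x d.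
Proof.
move=> xc /is_deriv_segP H; apply/is_deriv_segP => e /H[r r0 Hr].
exists (Num.min r (x - c)); first by rewrite lt_min r0 subr_gt0.
move=> y yab yx; rewrite lt_min => /andP[yr] yc.
by apply: Hr => //; have := ler_norm (x - y); lra.
Qed.

Lemma is_deriv_segD a b g g' x d d' k :
  is_deriv_seg a b g x d -> is_deriv_seg a b g' x d' ->
  is_deriv_seg a b (fun y => g y + k * g' y) x (d + k * d').
Proof.
move=> H H'; rewrite /is_deriv_seg.
rewrite (_ : (fun y => _) = (fun y => (g y - g x) / (y - x) +
   k * ((g' y - g' x) / (y - x)))); last by apply/funext => y; ring.
by apply: cvgD => //; apply: cvgM => //; exact: cvg_cst.
Qed.

Lemma is_deriv_seg_cst a b k x : is_deriv_seg a b (fun=> k) x 0.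
Proof.
apply/is_deriv_segP => e e0; exists 1 => // y _ _ _.
by rewrite !subrr mul0r subrr normr0.
Qed.

(** The factor [k] makes the rule iterable: it holds the sign [ep ^+ i] accumulated by the lower
    derivatives. *)
Lemma is_deriv_seg_aff a b a' b' c k ep g x d : ep = 1 \/ ep = -1 ->
  (forall y, a' <= y <= b' -> a <= c + ep * y <= b) ->
  is_deriv_seg a b g (c + ep * x) d ->
  is_deriv_seg a' b' (fun y => k * g (c + ep * y)) x (k * ep * d).
Proof.
move=> epE ab H.
have ep2 : ep * ep = 1 by case: epE => ->; rewrite ?mulrNN mulr1.
have nep : `|ep| = 1 by case: epE => ->; rewrite ?normrN normr1.
have H1 : is_deriv_seg a' b' (fun y => g (c + ep * y)) x (ep * d).
  move/is_deriv_segP : H => H; apply/is_deriv_segP => e /H[r r0 Hr].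
  exists r => // y yab yx xy.
  have D z : c + ep * x - (c + ep * z) = ep * (x - z) by ring.
  have D' z : (c + ep * z) - (c + ep * x) = ep * (z - x) by ring.
  have {}Hr := Hr (c + ep * y) (ab _ yab).
  rewrite -[ltLHS]mul1r -nep -normrM mulrBr mulrA ep2 mul1r mulrA.
  have -> : ep * (g (c + ep * y) - g (c + ep * x)) / (y - x) =
    (g (c + ep * y) - g (c + ep * x)) / (c + ep * y - (c + ep * x)).
    by rewrite D' invfM; case: epE => ->; rewrite ?invrN invr1; ring.
  apply: Hr; last by rewrite D normrM nep mul1r.
  by rewrite -subr_eq0 D' mulf_neq0 ?subr_eq0// -normr_eq0 nep oner_eq0.
move: (is_deriv_segD (k := k) (is_deriv_seg_cst a' b' 0 x) H1).
by rewrite add0r mulrA; congr is_deriv_seg; apply/funext => y; rewrite add0r.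
Qed.

End SegmentDerivative.

(** * Absolute continuity *)

Section AbsoluteContinuity.
Context {R : realType}.
Implicit Types (a b c x d k ep : R) (g : R -> R).

Definition abs_continuous_seg a b g : Prop :=
  forall eps : R, 0 < eps -> exists2 delta : R, 0 < delta &
  forall (n : nat) (u v : 'I_n -> R),
    (forall i, a <= u i /\ u i <= v i /\ v i <= b) ->
    (forall i j, i != j -> v i <= u j \/ v j <= u i) ->
    \sum_(i < n) (v i - u i) < delta ->
    \sum_(i < n) `|g (v i) - g (u i)| < eps.

Lemma eq_abs_continuous_seg a b g g' :
  (forall y, a <= y <= b -> g y = g' y) ->
  abs_continuous_seg a b g -> abs_continuous_seg a b g'.
Proof.
move=> E H eps /H[r r0 Hr]; exists r => // n u v uv dis /(Hr n u v uv dis).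
apply: le_lt_trans; apply: ler_sum => i _.
by have [au [uvi vb]] := uv i; rewrite !E //; lra.
Qed.

Lemma abs_continuous_seg_sub a b a' b' g : a <= a' -> b' <= b ->
  abs_continuous_seg a b g -> abs_continuous_seg a' b' g.
Proof.
move=> aa bb H eps /H[r r0 Hr]; exists r => // n u v uv; apply: Hr => i.
by have [? []] := uv i; lra.
Qed.

Lemma abs_continuous_segD a b g g' k :
  abs_continuous_seg a b g -> abs_continuous_seg a b g' ->
  abs_continuous_seg a b (fun y => g y + k * g' y).
Proof.
move=> H H' eps eps0.
have [r r0 Hr] := H (eps / 2) (divr_gt0 eps0 (ltr0Sn _ _)).
have k0 : 0 < `|k| + 1 by rewrite ltr_wpDl.
have [r' r'0 Hr'] := H' (eps / 2 / (`|k| + 1))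
  (divr_gt0 (divr_gt0 eps0 (ltr0Sn _ _)) k0).
exists (Num.min r r'); first by rewrite lt_min r0.
move=> n u v uv dis; rewrite lt_min => /andP[/(Hr n u v uv dis) h].
move=> /(Hr' n u v uv dis); rewrite ltr_pdivlMr // => h'.
apply: (@le_lt_trans _ _ (\sum_(i < n) `|g (v i) - g (u i)| +
    (\sum_(i < n) `|g' (v i) - g' (u i)|) * (`|k| + 1))); last by lra.
rewrite mulr_suml -big_split /=; apply: ler_sum => i _.
rewrite (_ : _ - _ = g (v i) - g (u i) + k * (g' (v i) - g' (u i))); last by ring.
rewrite (le_trans (ler_normD _ _)) // lerD2l normrM mulrC ler_wpM2l //.
by rewrite lerDl.
Qed.

Lemma abs_continuous_seg_cst a b k : abs_continuous_seg a b (fun=> k).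
Proof.
move=> eps eps0; exists 1 => // n u v _ _ _.
by rewrite big1 // => i _; rewrite subrr normr0.
Qed.

(** Each interval is clipped by min and max with c. The two increments of g add up to the original
    one, even for an interval straddling c, so the family never has to be sorted or cut. *)
Lemma abs_continuous_seg_cat a c b g : a <= c <= b ->
  abs_continuous_seg a c g -> abs_continuous_seg c b g ->
  abs_continuous_seg a b g.
Proof.
move=> acb H1 H2 eps eps0.
have [r1 r10 {}H1] := H1 (eps / 2) (divr_gt0 eps0 (ltr0Sn _ _)).
have [r2 r20 {}H2] := H2 (eps / 2) (divr_gt0 eps0 (ltr0Sn _ _)).
exists (Num.min r1 r2); first by rewrite lt_min r10.
move=> n u v uv dis; rewrite lt_min => /andP[h1 h2].
have B i : (Num.min (u i) c <= Num.min (v i) c) /\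
    (Num.max (u i) c <= Num.max (v i) c) /\
    Num.min (v i) c - Num.min (u i) c <= v i - u i /\
    Num.max (v i) c - Num.max (u i) c <= v i - u i /\
    a <= Num.min (u i) c /\ Num.min (v i) c <= c /\
    c <= Num.max (u i) c /\ Num.max (v i) c <= b.
  have [? [? ?]] := uv i.
  case/andP: acb => ac cb.
  case: (leP (u i) c) => uc; case: (leP (v i) c) => vc; repeat split;
    by rewrite ?lexx ?subrr //; lra.
have {}H1 := H1 n (fun i => Num.min (u i) c) (fun i => Num.min (v i) c).
have {}H2 := H2 n (fun i => Num.max (u i) c) (fun i => Num.max (v i) c).
have {}H1 : \sum_(i < n) `|g (Num.min (v i) c) - g (Num.min (u i) c)| < eps / 2.
  apply: H1 => [i|i j /dis ij|].
  - by have [? [? [? [? [? [? []]]]]]] := B i.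
  - by case: ij => ij; [left|right]; rewrite le_min ge_min ij ge_min lexx orbT.
  - apply: le_lt_trans h1; apply: ler_sum => i _.
    by have [? [? []]] := B i.
have {}H2 : \sum_(i < n) `|g (Num.max (v i) c) - g (Num.max (u i) c)| < eps / 2.
  apply: H2 => [i|i j /dis ij|].
  - by have [? [? [? [? [? [? []]]]]]] := B i.
  - by case: ij => ij; [left|right]; rewrite ge_max le_max ij le_max lexx orbT.
  - apply: le_lt_trans h2; apply: ler_sum => i _.
    by have [? [? [? []]]] := B i.
apply: (@le_lt_trans _ _
  (\sum_(i < n) `|g (Num.min (v i) c) - g (Num.min (u i) c)| +
   \sum_(i < n) `|g (Num.max (v i) c) - g (Num.max (u i) c)|)); last by lra.
rewrite -big_split /=; apply: ler_sum => i _.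
have := ler_normD (g (Num.min (v i) c) - g (Num.min (u i) c))
  (g (Num.max (v i) c) - g (Num.max (u i) c)).
apply: le_trans; rewrite le_eqVlt; apply/orP; left; apply/eqP; congr `|_|.
by case: (leP (u i) c) => uc; case: (leP (v i) c) => vc; ring.
Qed.

Lemma abs_continuous_seg_aff a b a' b' c k ep g : ep = 1 \/ ep = -1 ->
  (forall y, a' <= y <= b' -> a <= c + ep * y <= b) ->
  abs_continuous_seg a b g ->
  abs_continuous_seg a' b' (fun y => k * g (c + ep * y)).
Proof.
move=> epE ab H.
suff H' : abs_continuous_seg a' b' (fun y => g (c + ep * y)).
  have := @abs_continuous_segD a' b' _ _ k (@abs_continuous_seg_cst a' b' 0) H'.
  by apply: eq_abs_continuous_seg => y _; rewrite add0r.
move=> eps /H[r r0 Hr]; exists r => // n u v uv dis.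
case: epE => epE.
- move=> h; apply: (Hr n (fun i => c + ep * u i) (fun i => c + ep * v i)).
  + move=> i; have [? [? ?]] := uv i.
    by have := ab (u i); have := ab (v i); rewrite epE !mul1r; lra.
  + by move=> i j /dis; rewrite epE !mul1r !lerD2l.
  + apply: le_lt_trans h; apply: ler_sum => i _.
    by rewrite epE; lra.
(* A reflection exchanges the ends of each interval. *)
- move=> h; under eq_bigr do rewrite distrC.
  apply: (Hr n (fun i => c + ep * v i) (fun i => c + ep * u i)).
  + move=> i; have [? [? ?]] := uv i.
    by have := ab (u i); have := ab (v i); rewrite epE !mulN1r; lra.
  + by move=> i j /dis; rewrite epE !mulN1r !lerD2l !lerN2 => -[]; auto.
  + apply: le_lt_trans h; apply: ler_sum => i _.
    by rewrite epE; lra.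
Qed.

Lemma abs_continuous_seg_continuous a b g :
  abs_continuous_seg a b g -> {within `[a, b], continuous g}.
Proof.
move=> H; apply/subspace_continuousP => x; rewrite /= in_itv /= => xab.
apply/cvgrPdist_lt => e /H[r r0 Hr].
rewrite near_withinE; apply/nbhs_ballP; exists r => //= y xy.
rewrite in_itv /= => yab.
have := Hr 1%N (fun=> Num.min x y) (fun=> Num.max x y).
rewrite !big_ord1.
have -> : `|g (Num.max x y) - g (Num.min x y)| = `|g x - g y|.
  by case: leP => // _; rewrite distrC.
apply.
- by move=> _ /=; case: (leP x y) => ?; lra.
- by move=> i j; rewrite !ord1 eqxx.
- by move: xy; rewrite /ball /= ltr_norml /=; case: (leP x y) => _; lra.
Qed.

Lemma is_deriv_seg_continuous a b g :
  (forall x, a <= x <= b -> exists d, is_deriv_seg a b g x d) ->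
  {within `[a, b], continuous g}.
Proof.
move=> H; apply/subspace_continuousP => x; rewrite /= in_itv /= => xab.
have [d /is_deriv_segP Hd] := H x xab.
have [r r0 Hr] := Hd 1 ltr01.
apply/cvgrPdist_lt => e e0.
(* Near x the quotient is within 1 of d, so increments of g from x are at most |d| + 1 times the
   distance to x. *)
have d0 : 0 < `|d| + 1 by rewrite ltr_wpDl.
rewrite near_withinE; apply/nbhs_ballP.
exists (Num.min r (e / (`|d| + 1))); first by rewrite /= lt_min r0 divr_gt0.
move=> /= y; rewrite /ball /= lt_min ltr_pdivlMr // => /andP[xr xe].
rewrite in_itv /= => yab.
have [->|yx] := eqVneq y x; first by rewrite subrr normr0.
have {}Hr := Hr _ yab yx xr.
have yx0 : y - x != 0 by rewrite subr_eq0.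
rewrite distrC (_ : g y - g x = (g y - g x) / (y - x) * (y - x)); last first.
  by rewrite mulfVK.
rewrite normrM distrC in xe *; apply: le_lt_trans xe; rewrite mulrC ler_wpM2l //.
rewrite -(subrK d ((g y - g x) / (y - x))) addrC (le_trans (ler_normD _ _)) //.
by rewrite lerD2l distrC ltW.
Qed.

End AbsoluteContinuity.

(** * Lebesgue integration *)

Section NonmeasurableIntegrand.
Local Open Scope ereal_scope.
Context d (T : measurableType d) (R : realType).
Variable mu : {measure set T -> \bar R}.

Let ge0_le_integral_any (f g : T -> \bar R) :
  (forall x, 0 <= f x) -> (forall x, f x <= g x) ->
  \int[mu]_x f x <= \int[mu]_x g x.
Proof.
move=> f0 fg; have g0 x : 0 <= g x by exact: le_trans (f0 x) (fg x).
rewrite !ge0_integralTE //; apply: le_ereal_sup => _ [h /= hf <-].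
by exists h => // x; exact: le_trans (hf x) (fg x).
Qed.

(** Replacing g on the null set N by 0 or by +oo gives measurable functions below and above f with
    the same integral as g. Monotonicity, which needs no measurability, squeezes the integral of f
    between them. *)
Let ge0_ae_eq_integral_any (f g : T -> \bar R) :
  (forall x, 0 <= f x) -> (forall x, 0 <= g x) -> measurable_fun [set: T] g ->
  {ae mu, forall x, f x = g x} -> \int[mu]_x f x = \int[mu]_x g x.
Proof.
move=> f0 g0 mg [N [mN N0 subN]].
have out x : x \notin N -> f x = g x.
  move=> xN; apply: contrapT => fg; move: xN; apply/negP/negPn.
  by rewrite inE; exact: subN.
have aeN (k : \bar R) : {ae mu, forall x, [set: T] x ->
    (if x \in N then k else g x) = g x}.
  exists N; split => // x /= /not_implyP[_]; case: ifPn => // xN _.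
  exact: set_mem.
have mN' (k : \bar R) :
    measurable_fun [set: T] (fun x => if x \in N then k else g x).
  apply: measurable_fun_ifT => //.
  apply: (measurable_fun_bool true); rewrite setTI.
  rewrite [X in measurable X](_ : _ = N) //.
  by apply/seteqP; split => x /=; [exact: set_mem|exact: mem_set].
apply/eqP; rewrite eq_le; apply/andP; split.
- rewrite -(ge0_ae_eq_integral _ (mN' +oo) mg _ _ (aeN +oo)) //; last first.
    by move=> x _; case: ifP.
  apply: ge0_le_integral_any => // x; case: ifPn => [_|/out ->//].
  exact: leey.
- rewrite -(ge0_ae_eq_integral _ (mN' 0) mg _ _ (aeN 0)) //; last first.
    by move=> x _; case: ifP.
  by apply: ge0_le_integral_any => x; case: ifPn => // /out ->.
Qed.

(* Unlike [ae_eq_integral], this does not require [f] to be measurable: the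
   integral is a supremum over simple functions below the integrand. *)
Lemma ae_eq_integral_any (D : set T) (f g : T -> \bar R) :
  measurable D -> measurable_fun D g ->
  {ae mu, forall x, D x -> f x = g x} ->
  \int[mu]_(x in D) f x = \int[mu]_(x in D) g x.
Proof.
move=> mD mg fg; rewrite integralE [RHS]integralE.
rewrite ![integral mu D _]integral_mkcond.
have mp : measurable_fun [set: T] (g^\+ \_ D).
  by apply/(measurable_restrictT _ mD)/measurable_funepos.
have mn : measurable_fun [set: T] (g^\- \_ D).
  by apply/(measurable_restrictT _ mD)/measurable_funeneg.
congr (_ - _); apply: ge0_ae_eq_integral_any => //.
- by move=> x; rewrite patchE; case: ifP.
- by move=> x; rewrite patchE; case: ifP.
- apply: filterS fg => x fg; rewrite !patchE; case: ifPn => // /set_mem xD.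
  by rewrite !unlock fg.
- by move=> x; rewrite patchE; case: ifP.
- by move=> x; rewrite patchE; case: ifP.
- apply: filterS fg => x fg; rewrite !patchE; case: ifPn => // /set_mem xD.
  by rewrite !unlock fg.
Qed.

End NonmeasurableIntegrand.

(** * Translations and reflections of the line *)

Section AffineInvariance.
Context {R : realType}.
Notation mu := (@lebesgue_measure R).
Variables (c ep : R).
Hypothesis epE : ep = 1 \/ ep = -1.
Let sig := fun x : measurableTypeR R => (c + ep * x : measurableTypeR R).

Lemma measurable_aff : measurable_fun [set: R] (fun x : R => c + ep * x).
Proof.
by apply: measurable_funD => //; apply: measurable_funM.
Qed.

(** By uniqueness of Lebesgue measure, half-open intervals suffice; a reflection moves the closed
    end to the other side without changing the length. *)
Lemma lebesgue_measure_aff (A : set R) : measurable A ->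
  mu ((fun x => c + ep * x) @^-1` A) = mu A.
Proof.
move=> mA; symmetry.
pose m := measure_function_pushforward__canonical__measure_function_Measure
  mu (measurable_aff : measurable_fun [set: measurableTypeR R] sig).
have := @lebesgue_measure_unique R m _ A mA; apply => _ [[a b] _ <-] /=.
rewrite /pushforward /=.
case: epE => E.
- rewrite (_ : _ @^-1` _ = `]a - c, b - c]%classic); last first.
    by apply/seteqP; split => x; rewrite /sig /= !in_itv /= E mul1r; lra.
  rewrite !lebesgue_measure_itv /= !lte_fin ltrD2r.
  by case: ifP => // _; rewrite -!EFinB; congr (_%:E); ring.
- rewrite (_ : _ @^-1` _ = `[c - b, c - a[%classic); last first.
    by apply/seteqP; split => x; rewrite /sig /= !in_itv /= E mulN1r; lra.
  rewrite !lebesgue_measure_itv /= !lte_fin ltrD2l ltrN2.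
  by case: ifP => // _; rewrite -!EFinB; congr (_%:E); ring.
Qed.

Lemma ae_aff (P : R -> Prop) :
  {ae mu, forall x, P x} -> {ae mu, forall x, P (c + ep * x)}.
Proof.
move=> [N [mN N0 sub]]; exists ((fun x => c + ep * x) @^-1` N); split.
- by rewrite -[X in measurable X]setTI; exact: measurable_aff.
- exact: etrans (lebesgue_measure_aff mN) N0.
- by move=> x /= ?; apply: sub.
Qed.

Lemma integrable_aff (D : set R) (f : R -> \bar R) :
  measurable D -> measurable_fun [set: R] f ->
  mu.-integrable D f ->
  mu.-integrable ((fun x => c + ep * x) @^-1` D) (fun x => f (c + ep * x)).
Proof.
move=> mD mf /integrableP[_ h]; apply/integrableP; split.
  apply: (measurable_funS measurableT) => //.
  exact: (measurableT_comp mf measurable_aff).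
move: h; congr (_ < _)%E.
rewrite -(@ge0_integral_pushforward _ _ _ _ _ sig measurable_aff mu D
  (fun x => `|f x|)%E) //; last first.
  by apply/measurable_funTS; exact: measurableT_comp.
apply: eq_measure_integral; first exact: measurable_aff.
by move=> ? A mA _; exact: esym (lebesgue_measure_aff mA).
Qed.

Lemma Rintegral_aff (D : set R) (f : R -> R) :
  measurable D -> measurable_fun [set: R] f ->
  mu.-integrable D (EFin \o f) ->
  \int[mu]_(x in (fun x => c + ep * x) @^-1` D) f (c + ep * x) =
  \int[mu]_(x in D) f x.
Proof.
move=> mD mf fi; congr fine.
have mf' : measurable_fun [set: R] (EFin \o f) by exact/measurable_EFinP.
rewrite -(@integral_pushforward _ _ _ _ _ sig measurable_aff mu D
  (EFin \o f)) //; last first.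
  exact: integrable_aff.
apply: eq_measure_integral; first exact: measurable_aff.
by move=> ? A mA _; exact: lebesgue_measure_aff.
Qed.

End AffineInvariance.

(** * Square-integrable functions on a segment *)

Section SquareIntegrable.
Context {R : realType}.
Implicit Types (a b c k ep : R) (h : R -> R).
Notation mu := (@lebesgue_measure R).

(** Measurability is asked on the whole line, so that composing with affine maps and gluing at a
    point need no bookkeeping of domains. *)
Definition sq_integrable a b h : Prop :=
  measurable_fun [set: R] h /\
  mu.-integrable `[a, b] (EFin \o (fun x => h x ^+ 2)).

Lemma sq_integrable_mul a b h h' : sq_integrable a b h ->
  sq_integrable a b h' -> mu.-integrable `[a, b] (EFin \o (fun x => h x * h' x)).
Proof.
move=> [mh ih] [mh' ih'].
apply: (@le_integrable _ _ _ mu _ _ _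
  (fun x => (h x ^+ 2)%:E + (h' x ^+ 2)%:E)%E) => //.
- by apply/measurable_EFinP/measurable_funTS/measurable_funM.
- move=> x _ /=; rewrite lee_fin [leRHS]ger0_norm ?addr_ge0 ?sqr_ge0 //.
  by rewrite ler_norml; apply/andP; split; nra.
- exact: integrableD.
Qed.

Lemma sq_integrableD a b h h' k : sq_integrable a b h -> sq_integrable a b h' ->
  sq_integrable a b (fun x => h x + k * h' x).
Proof.
move=> H H'; split.
  apply: measurable_funD; first exact: H.1.
  by apply: measurable_funM => //; exact: H'.1.
have I := sq_integrable_mul H H'.
rewrite (_ : _ \o _ = (fun x => (h x ^+ 2)%:E +
   ((2 * k)%:E * (h x * h' x)%:E + (k ^+ 2)%:E * (h' x ^+ 2)%:E))%E).
  apply: integrableD => //; first exact: H.2.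
  by apply: integrableD => //; apply: integrableZl => //; exact: H'.2.
by apply/funext => x /=; congr (_%:E); ring.
Qed.

Lemma sq_integrable_cst a b k : sq_integrable a b (fun=> k).
Proof.
split; first exact: measurable_cst.
apply/integrableP; split; first by apply/measurable_EFinP; exact: measurable_cst.
rewrite integral_cst //= lebesgue_measure_itv /=.
by case: ifP => _; rewrite ?mule0 // -EFinB -EFinM ltry.
Qed.

Lemma sq_integrable_sub a b a' b' h : a <= a' -> b' <= b ->
  sq_integrable a b h -> sq_integrable a' b' h.
Proof.
move=> aa bb [mh ih]; split => //; apply: integrableS ih => //.
by move=> x /=; rewrite !in_itv /=; lra.
Qed.

Lemma sq_integrable_cat a c b h h' :
  sq_integrable a c h -> sq_integrable c b h' ->
  sq_integrable a b (fun x => if x <= c then h x else h' x).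
Proof.
move=> [mh ih] [mh' ih'].
have mc : measurable_fun [set: R] (fun x => x <= c).
  by apply: measurable_fun_ler.
have m : measurable_fun [set: R] (fun x => if x <= c then h x else h' x).
  exact: measurable_fun_ifT.
split => //.
pose F := EFin \o (fun x => (if x <= c then h x else h' x) ^+ 2).
have mF : measurable_fun [set: R] F.
  by apply/measurable_EFinP; exact: measurable_funX.
apply: (@integrableS _ _ _ mu (`[a, c]%classic `|` `]c, b]%classic)) => //.
- exact: measurableU.
- by move=> x /=; rewrite !in_itv /=; case: (leP x c) => xc; [left|right]; lra.
have I1 : mu.-integrable `[a, c] F.
  apply: eq_integrable ih => // x; rewrite inE /= in_itv /= => /andP[_ xc].
  by rewrite /F /= xc.
have I2 : mu.-integrable `]c, b] F.
  have : mu.-integrable `]c, b] (EFin \o (fun x => h' x ^+ 2)).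
    by apply: integrableS ih' => // x /=; rewrite !in_itv /=; lra.
  apply: eq_integrable => // x; rewrite inE /= in_itv /= => /andP[xc _].
  by rewrite /F /= leNgt xc.
apply/integrableP; split; first exact: measurable_funTS.
have mF' : measurable_fun [set: R] (fun x => `|F x|%E) by exact: measurableT_comp.
rewrite ge0_integral_setU //; last 2 first.
- exact: measurable_funTS.
- by apply/disj_setPS => x [] /=; rewrite !in_itv /=; lra.
case/integrableP : I1 => _ I1; case/integrableP : I2 => _.
exact: lte_add_pinfty.
Qed.

Lemma sq_integrable_aff a b a' b' c k ep h : ep = 1 \/ ep = -1 ->
  (forall y, (a' <= y <= b') = (a <= c + ep * y <= b)) ->
  sq_integrable a b h -> sq_integrable a' b' (fun x => k * h (c + ep * x)).
Proof.
move=> epE ab [mh ih].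
have H : sq_integrable a' b' (fun x => h (c + ep * x)).
  split; first exact: (measurableT_comp mh (measurable_aff c ep)).
  rewrite (_ : `[a', b']%classic = (fun x => c + ep * x) @^-1` `[a, b]%classic).
    apply: (@integrable_aff _ c ep epE `[a, b]%classic
      (EFin \o (fun x => h x ^+ 2))) => //.
    by apply/measurable_EFinP; exact: measurable_funX.
  by apply/seteqP; split => x; rewrite /= !in_itv /= ab.
have := @sq_integrableD a' b' (fun=> 0) _ k (sq_integrable_cst a' b' 0) H.
by congr sq_integrable; apply/funext => x; rewrite add0r.
Qed.

Definition pairing a b h h' := \int[mu]_(t in `[a, b]) (h t * h' t).

Lemma pairingDr a b h0 h h' k : sq_integrable a b h0 -> sq_integrable a b h ->
  sq_integrable a b h' ->
  pairing a b h0 (fun x => h x + k * h' x) =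
  pairing a b h0 h + k * pairing a b h0 h'.
Proof.
move=> H0 H H'; rewrite /pairing -RintegralZl //; last exact: sq_integrable_mul.
rewrite -RintegralD //; last 2 first.
- exact: sq_integrable_mul.
- by have := @integrableZl _ _ _ mu _ _ k _ (sq_integrable_mul H0 H'); apply.
by apply: eq_Rintegral => t _; ring.
Qed.

(** In use [k] is the sign that the affine map puts on derivatives of order m + 1; it occurs twice
    in the product. *)
Lemma pairing_aff a b a' b' c k ep h h' : ep = 1 \/ ep = -1 -> k * k = 1 ->
  (forall y, (a' <= y <= b') = (a <= c + ep * y <= b)) ->
  sq_integrable a b h -> sq_integrable a b h' ->
  pairing a' b' (fun x => k * h (c + ep * x)) (fun x => k * h' (c + ep * x)) =
  pairing a b h h'.
Proof.
move=> epE k2 ab H H'; rewrite /pairing.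
rewrite -(@Rintegral_aff _ c ep epE `[a, b]%classic (fun x => h x * h' x)) //;
  last 2 first.
- by apply: measurable_funM; [exact: H.1|exact: H'.1].
- exact: sq_integrable_mul.
rewrite (_ : `[a', b']%classic = (fun x => c + ep * x) @^-1` `[a, b]%classic).
  by apply: eq_Rintegral => x _; rewrite mulrACA k2 mul1r.
by apply/seteqP; split => x; rewrite /= !in_itv /= ab.
Qed.

Lemma pairing_cat a c b h h' : a <= c <= b ->
  sq_integrable a b h -> sq_integrable a b h' ->
  pairing a b h h' = pairing a c h h' + pairing c b h h'.
Proof.
move=> /andP[ac cb] H H'; have I := sq_integrable_mul H H'.
have Icb : mu.-integrable `]c, b] (EFin \o (fun x => h x * h' x)).
  by apply: integrableS I => // x /=; rewrite !in_itv /=; lra.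
rewrite /pairing -[in X in _ + X](Rintegral_itv_obnd_cbnd Icb).
rewrite -Rintegral_setU //.
- by rewrite -itv_bndbnd_setU // bnd_simp.
- by rewrite -itv_bndbnd_setU // bnd_simp.
- by apply/disj_setPS => x [] /=; rewrite !in_itv /=; lra.
Qed.

End SquareIntegrable.

(** * Sobolev functions on a segment *)

Section SobolevTower.
Context {R : realType}.
Implicit Types (a b c k ep l x : R) (g h : R -> R) (F : nat -> R -> R) (m i : nat).
Notation mu := (@lebesgue_measure R).

#[local] Instance ae_lebesgue_filter : Filter (almost_everywhere mu).
Proof. exact: ae_filter_ringOfSetsType. Qed.

(* [F i], i <= m, are the derivatives of g, and h represents almost everywhere
   the one of order m + 1.  Carrying them explicitly avoids the default values
   of [derivn_on]. *)
Record tower a b m g F h : Prop := Tower {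
  tower0 : forall x, a <= x <= b -> F 0%N x = g x;
  towerS : forall i x, (i < m)%N -> a <= x <= b ->
    is_deriv_seg a b (F i) x (F i.+1 x);
  tower_ac : abs_continuous_seg a b (F m);
  tower_sq : sq_integrable a b h;
  tower_ae : {ae mu, forall x, a <= x <= b -> is_deriv_seg a b (F m) x (h x)} }.

Lemma eq_tower a b m g g' F h : (forall x, a <= x <= b -> g x = g' x) ->
  tower a b m g F h -> tower a b m g' F h.
Proof. by move=> E [H0 HS Hac Hsq Hae]; split => // x xab; rewrite -E // H0. Qed.

Lemma towerD a b m g g' F F' h h' k :
  tower a b m g F h -> tower a b m g' F' h' ->
  tower a b m (fun x => g x + k * g' x) (fun i x => F i x + k * F' i x)
    (fun x => h x + k * h' x).
Proof.
move=> [H0 HS Hac Hsq Hae] [H0' HS' Hac' Hsq' Hae']; split.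
- by move=> x xab; rewrite H0 // H0'.
- by move=> i x im xab; apply: is_deriv_segD; [exact: HS|exact: HS'].
- exact: abs_continuous_segD.
- exact: sq_integrableD.
- move: Hae Hae'; apply: filterS2 => x H H' xab.
  by apply: is_deriv_segD; [exact: H|exact: H'].
Qed.

Lemma tower_cst a b m k :
  tower a b m (fun=> k) (fun i _ => if i is 0%N then k else 0) (fun=> 0).
Proof.
split => //.
- by move=> [|i] x _ _; exact: is_deriv_seg_cst.
- by case: m => [|m]; exact: abs_continuous_seg_cst.
- exact: sq_integrable_cst.
- by apply: aeW => x _; case: m => [|m]; exact: is_deriv_seg_cst.
Qed.

Lemma tower_aff a b a' b' c ep m g F h : ep = 1 \/ ep = -1 ->
  (forall y, (a' <= y <= b') = (a <= c + ep * y <= b)) ->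
  tower a b m g F h ->
  tower a' b' m (fun x => g (c + ep * x)) (fun i x => ep ^+ i * F i (c + ep * x))
    (fun x => ep ^+ m.+1 * h (c + ep * x)).
Proof.
move=> epE ab [H0 HS Hac Hsq Hae].
have ab' y : a' <= y <= b' -> a <= c + ep * y <= b by rewrite ab.
split.
- by move=> x xab; rewrite mul1r H0 // -ab.
- move=> i x im xab; rewrite exprSr.
  by apply: is_deriv_seg_aff ab' _ => //; apply: HS => //; rewrite -ab.
- exact: abs_continuous_seg_aff ab' Hac.
- exact: sq_integrable_aff ab Hsq.
- apply: filterS (ae_aff c epE Hae) => x H xab; rewrite exprSr.
  by apply: is_deriv_seg_aff ab' _ => //; apply: H; rewrite -ab.
Qed.

Lemma tower_sub a b a' b' m g F h : a <= a' -> b' <= b ->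
  tower a b m g F h -> tower a' b' m g F h.
Proof.
move=> aa bb [H0 HS Hac Hsq Hae].
have ab' y : a' <= y <= b' -> a <= y <= b by lra.
split.
- by move=> x /ab'; exact: H0.
- by move=> i x im xab; apply: is_deriv_seg_sub (HS _ _ im (ab' _ xab)).
- exact: abs_continuous_seg_sub Hac.
- exact: sq_integrable_sub Hsq.
- by apply: filterS Hae => x H /ab'/H; exact: is_deriv_seg_sub.
Qed.

Definition glue c g g' x : R := if x <= c then g x else g' x.

Lemma glue_left a c g g' x : a <= x <= c -> glue c g g' x = g x.
Proof. by rewrite /glue => /andP[_ ->]. Qed.

Lemma glue_right c b g g' x : g c = g' c -> c <= x <= b -> glue c g g' x = g' x.
Proof.
rewrite /glue => gg /andP[cx _]; case: ifPn => // xc.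
by have -> : x = c by apply/eqP; rewrite eq_le xc.
Qed.

(** For i < m, the left and right derivatives at c of the glued function of order i are [F i.+1 c]
    and [F' i.+1 c], equal by hypothesis. Order m + 1 needs no matching, since c is a null set. *)
Lemma tower_cat a c b m g F F' h h' : a <= c <= b ->
  (forall i, (i <= m)%N -> F i c = F' i c) ->
  tower a c m g F h -> tower c b m g F' h' ->
  tower a b m g (fun i => glue c (F i) (F' i)) (glue c h h').
Proof.
move=> acb E [H0 HS Hac Hsq Hae] [H0' HS' Hac' Hsq' Hae'].
have left i : forall y, a <= y <= c -> F i y = glue c (F i) (F' i) y.
  by move=> y /glue_left ->.
have right i : (i <= m)%N ->
    forall y, c <= y <= b -> F' i y = glue c (F i) (F' i) y.
  by move=> /E/glue_right H y /H ->.
split.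
- move=> x xab; rewrite /glue; case: (leP x c) => xc.
    by apply: H0; lra.
  by apply: H0'; lra.
- move=> i x im xab; case: (ltgtP x c) => xc.
  + apply: (is_deriv_seg_left _ xc); rewrite -left; last by lra.
    by apply: (eq_is_deriv_seg _ (left i)) (HS _ _ _ _) => //; lra.
  + apply: (is_deriv_seg_right _ xc); rewrite -right //; last by lra.
    by apply: (eq_is_deriv_seg _ (right i (ltnW im))) (HS' _ _ _ _) => //; lra.
  + apply: (@is_deriv_seg_cat _ _ c).
    * rewrite -left; last by lra.
      by apply: (eq_is_deriv_seg _ (left i)) (HS _ _ _ _) => //; lra.
    * rewrite -right //; last by lra.
      by apply: (eq_is_deriv_seg _ (right i (ltnW im))) (HS' _ _ _ _) => //; lra.
- apply: (@abs_continuous_seg_cat _ _ c) => //.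
  + exact: (eq_abs_continuous_seg (left m)).
  + exact: (eq_abs_continuous_seg (right m (leqnn m))).
- exact: sq_integrable_cat.
(* At c itself the one-sided derivatives of order m + 1 may disagree. *)
- have Hc : {ae mu, forall x, x != c}.
    exists [set c]; split; [exact: measurable_set1|exact: lebesgue_measure_set1|].
    by move=> x /= /negP/negPn/eqP.
  move: Hae Hae' Hc; apply: filterS3 => x H H' xNc xab.
  rewrite /glue; case: (ltgtP x c) => xc.
  + apply: (is_deriv_seg_left _ xc).
    by apply: (eq_is_deriv_seg _ (left m)) (H _) => //; lra.
  + apply: (is_deriv_seg_right _ xc).
    by apply: (eq_is_deriv_seg _ (right m (leqnn m))) (H' _) => //; lra.
  + by rewrite xc eqxx in xNc.
Qed.

Definition sobolev l m g : Prop :=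
  [/\ Cm_on l m g, abs_continuous_on l (derivn_on l m g) &
      deriv_in_L2 l (derivn_on l m g)].

(** Limits being unique, induction on the order shows that no default value of [derivn_on] occurs up
    to order m. *)
Lemma tower_derivn l m g F h : 0 < l -> tower 0 l m g F h ->
  forall i x, (i <= m)%N -> 0 <= x <= l -> derivn_on l i g x = F i x.
Proof.
move=> l0 T; elim=> [|i IH] x im xl; first by rewrite (tower0 T).
apply: is_deriv_seg_unique => //.
apply: eq_is_deriv_seg (towerS T im xl) => // y yl.
by apply/esym/IH => //; exact: ltnW.
Qed.

Lemma sobolev_tower l m g : 0 < l -> sobolev l m g ->
  exists h, tower 0 l m g (fun i => derivn_on l i g) h.
Proof.
move=> l0 [[Hd Hc] Hac [h [mh ih Hae]]].
have sqE x : ((h \_ `[0, l]) x) ^+ 2 = ((fun x => h x ^+ 2) \_ `[0, l]) x.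
  by rewrite !patchE; case: ifP => // _; rewrite expr0n.
(* Extension by 0 turns measurability on the segment into measurability on the line. *)
exists (h \_ `[0, l]); split => //.
- move=> i x im xl; have [|d Hx] := Hd i im x; first by rewrite in_itv.
  by rewrite /= -[X in is_deriv_seg _ _ _ _ X]/(deriv_on l (derivn_on l i g) x)
    [X in is_deriv_seg _ _ _ _ X](is_deriv_seg_unique l0 xl Hx).
- split; first by apply/(measurable_restrictT _ (measurable_itv `[0, l])).
  apply: (@eq_integrable _ _ _ mu _ _ (EFin \o (fun x => h x ^+ 2))) => //.
    by move=> x xl; rewrite /= patchE xl.
  apply/integrableP; split.
    by apply/measurable_EFinP; exact: measurable_funX.
  apply: le_lt_trans ih; rewrite le_eqVlt; apply/orP; left; apply/eqP.
  by apply: eq_integral => x _; rewrite /= ger0_norm // sqr_ge0.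
- apply: filterS Hae => x H xl; rewrite patchE mem_set /= ?in_itv //.
  by apply: H; rewrite in_itv.
Qed.

Lemma tower_sobolev l m g F h : 0 < l -> tower 0 l m g F h -> sobolev l m g.
Proof.
move=> l0 T; have E := tower_derivn l0 T.
have E' i : (i <= m)%N -> forall y, 0 <= y <= l -> F i y = derivn_on l i g y.
  by move=> im y /(E _ _ im) ->.
have HS i x : (i < m)%N -> 0 <= x <= l -> is_deriv_on l (derivn_on l i g) x (F i.+1 x).
  move=> im xl; apply: eq_is_deriv_seg (towerS T im xl) => //.
  exact: E' (ltnW im).
have Hac : abs_continuous_on l (derivn_on l m g).
  exact: eq_abs_continuous_seg (E' m (leqnn m)) (tower_ac T).
split => //.
- split=> [i im x|i]; first by rewrite in_itv => xl; exists (F i.+1 x); exact: HS.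
  (* Continuity comes from absolute continuity at order m, and from differentiability below. *)
  rewrite leq_eqVlt => /predU1P[->|im].
    exact: abs_continuous_seg_continuous.
  apply: is_deriv_seg_continuous => x xl; exists (F i.+1 x); exact: HS.
- have [mh /integrableP[_ ih]] := tower_sq T.
  exists h; split; first exact: measurable_funTS.
    apply: le_lt_trans ih; rewrite le_eqVlt; apply/orP; left; apply/eqP.
    by apply: eq_integral => x _; rewrite /= ger0_norm // sqr_ge0.
  apply: filterS (tower_ae T) => x H; rewrite in_itv /= => xl.
  by apply: eq_is_deriv_seg (H xl) => //; exact: E'.
Qed.

(** Where the derivative of order m + 1 fails to exist, the left integrand is made of default values
    and is not known to be measurable; hence the use of [ae_eq_integral_any]. *)
Lemma pairing_tower l m g g' F F' h h' : 0 < l ->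
  tower 0 l m g F h -> tower 0 l m g' F' h' ->
  \int[mu]_(t in `[0, l]) (derivn_on l m.+1 g t * derivn_on l m.+1 g' t) =
  pairing 0 l h h'.
Proof.
move=> l0 T T'.
have dE u U w : tower 0 l m u U w ->
    {ae mu, forall x, 0 <= x <= l -> derivn_on l m.+1 u x = w x}.
  move=> S; apply: filterS (tower_ae S) => x H xl.
  apply: (@is_deriv_seg_unique _ _ _ (derivn_on l m u)) => //.
  by apply: eq_is_deriv_seg (H xl) => // y yl; rewrite (tower_derivn l0 S).
rewrite /pairing; congr fine; apply: ae_eq_integral_any => //.
  apply/measurable_EFinP/measurable_funTS/measurable_funM.
    exact: (tower_sq T).1.
  exact: (tower_sq T').1.
move: (dE _ _ _ T) (dE _ _ _ T'); apply: filterS2 => x H H'.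
by rewrite /= in_itv => xl; congr (_ * _)%:E; [exact: H|exact: H'].
Qed.

End SobolevTower.

(** * Functions on a metric graph *)

Section GraphSpace.
Context {R : realType} (m : nat) (G : mgraph R).
Implicit Types (f g : gpoint G -> R) (e : edge G) (v : 'I_(nv G)) (k : R).

(** This is [in_F] without the normalization: it contains the constants, and it is what all the
    identifications of graphs preserve. *)
Definition smooth f : Prop :=
  (forall e, sobolev (len e) m (on_edge f e)) /\
  (forall v i, (i <= m)%N -> kirchhoff i f v).

Lemma in_F_smooth f : in_F m.+1 f <-> smooth f /\ \sum_v f (inl v) = 0.
Proof.
split=> [[[H1 H2] H3 H4 H5]|[[H H2] H5]].
  by [].
by split=> [|e|e|//]; [split => // e| |]; case: (H e).
Qed.

(** Leaving an edge through its target runs it backwards, and each derivative then changes sign. *)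
Lemma tower_exit f e v F h : tower 0 (len e) m (on_edge f e) F h ->
  exists F' h', tower 0 (len e) m (fun t => f (exit_pt e v t)) F' h' /\
    forall i, F' i 0 = if src e == v then F i 0 else (-1) ^+ i * F i (len e).
Proof.
rewrite /exit_pt; case: (src e == v) => T; first by exists F, h.
have ab (y : R) : (0 <= y <= len e) = (0 <= len e + -1 * y <= len e).
  by apply/idP/idP; lra.
have N1 : (-1 : R) = 1 \/ (-1 : R) = -1 by right.
exists (fun i x => (-1) ^+ i * F i (len e + -1 * x)),
  (fun x => (-1) ^+ m.+1 * h (len e + -1 * x)); split.
  apply: eq_tower (tower_aff N1 ab T) => x _.
  by rewrite /on_edge mulN1r.
by move=> i; rewrite mulr0 addr0.
Qed.

Lemma exit_deriv_tower i f e v F h : (i <= m)%N ->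
  tower 0 (len e) m (on_edge f e) F h ->
  exit_deriv i f e v = if src e == v then F i 0 else (-1) ^+ i * F i (len e).
Proof.
move=> im /(tower_exit v)[F' [h' [T <-]]].
by apply: tower_derivn (len_gt0 e) T _ _ im _; rewrite lexx ltW ?len_gt0.
Qed.

Lemma smooth_tower f e : smooth f ->
  exists h, tower 0 (len e) m (on_edge f e)
    (fun i => derivn_on (len e) i (on_edge f e)) h.
Proof. by move=> [H _]; apply: sobolev_tower (len_gt0 e) (H e). Qed.

Lemma smoothD f g k : smooth f -> smooth g -> smooth (fun x => f x + k * g x).
Proof.
move=> sf sg; split=> [e|v i im].
  have [h T] := smooth_tower e sf; have [h' T'] := smooth_tower e sg.
  exact: tower_sobolev (len_gt0 e) (towerD k T T').
have D e : exit_deriv i (fun x => f x + k * g x) e v =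
    exit_deriv i f e v + k * exit_deriv i g e v.
  have [h T] := smooth_tower e sf; have [h' T'] := smooth_tower e sg.
  rewrite (exit_deriv_tower v im T) (exit_deriv_tower v im T').
  rewrite (exit_deriv_tower v im (towerD k T T')).
  by case: ifP => _ //; ring.
have := sf.2 v i im; have := sg.2 v i im; rewrite /kirchhoff.
case: (odd i) => Hg Hf.
  by under eq_bigr do rewrite D; rewrite big_split -mulr_sumr /= Hf Hg mulr0 addr0.
by move=> e e' ve ve'; rewrite !D (Hf e e') // (Hg e e').
Qed.

Lemma smooth_cst k : smooth (fun=> k).
Proof.
have T e : tower 0 (len e) m (on_edge (fun=> k) e) _ _ :=
  tower_cst 0 (len e) m k.
split=> [e|v i im]; first exact: tower_sobolev (len_gt0 e) (T e).
have D e : exit_deriv i (fun=> k) e v = if i is 0%N then k else 0.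
  by rewrite (exit_deriv_tower v im (T e)); case: ifP => // _; case: i {im} => [|i];
    rewrite ?mul1r ?mulr0.
rewrite /kirchhoff; case: ifP => oi; last by move=> e e' _ _; rewrite !D.
by rewrite big1 // => e _; rewrite D; case: i oi {im D}.
Qed.

Lemma innerFC f g : innerF m.+1 f g = innerF m.+1 g f.
Proof.
by apply: eq_bigr => e _; apply: eq_Rintegral => t _; rewrite mulrC.
Qed.

Lemma innerFDr f g g' k : smooth f -> smooth g -> smooth g' ->
  innerF m.+1 f (fun x => g x + k * g' x) =
  innerF m.+1 f g + k * innerF m.+1 f g'.
Proof.
move=> sf sg sg'; rewrite /innerF mulr_sumr -big_split; apply: eq_bigr => e _.
have [h T] := smooth_tower e sf; have [h' T'] := smooth_tower e sg.
have [h'' T''] := smooth_tower e sg'; have l0 := len_gt0 e.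
rewrite (pairing_tower l0 T T') (pairing_tower l0 T T'').
rewrite (pairing_tower l0 T (towerD k T' T'')) pairingDr //.
- exact: tower_sq T.
- exact: tower_sq T'.
- exact: tower_sq T''.
Qed.

Lemma innerF_cst f k : smooth f -> innerF m.+1 f (fun=> k) = 0.
Proof.
move=> sf; rewrite /innerF big1 // => e _; have [h T] := smooth_tower e sf.
rewrite (pairing_tower (len_gt0 e) T (tower_cst 0 (len e) m k)) /pairing.
under eq_Rintegral do rewrite mulr0.
by rewrite Rintegral_cst // mul0r.
Qed.

End GraphSpace.

(** * Transferring the variogram along a bijection *)

Section Moments.
Context {R : realType} d (T : measurableType d) (P : probability T R).
Implicit Types (X Y B : {RV P >-> R}) (k r : R).

(** For a centered X, the covariance with itself is the second moment. *)
Lemma centered_Lfun2 X r : ('E_P[X] = 0)%E -> covariance P X X = r%:E ->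
  (X : T -> R) \in Lfun P 2%:E.
Proof.
move=> EX; rewrite covariance.unlock EX /= expectation.unlock => H.
rewrite inE; apply/andP; split; rewrite inE //=.
rewrite /finite_norm unlock /=; apply: poweR_lty.
rewrite (_ : integral _ _ _ = r%:E) ?ltry // -H; apply: eq_integral => x _ /=.
by rewrite powR_mulrn// real_normK ?num_real// !fctE/= subr0 expr2.
Qed.

Lemma measurable_addZ X B k : measurable_fun [set: T] (fun w => X w + k * B w).
Proof. by apply: measurable_funD => //; exact: measurable_funM. Qed.

Definition addZ X B k : {RV P >-> R} :=
  HB.pack (fun w => X w + k * B w)
    (isMeasurableFun.Build _ _ _ _ _ (measurable_addZ X B k)).

Lemma addZE X B k w : addZ X B k w = X w + k * B w.
Proof. by []. Qed.

Let addZ_fun X B k : (addZ X B k : T -> R) = ((X : T -> R) \+ k \o* (B : T -> R)).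
Proof. by apply/funext => w; rewrite addZE mulrC. Qed.

Lemma expectation_addZ X B k :
  (X : T -> R) \in Lfun P 2%:E -> (B : T -> R) \in Lfun P 2%:E ->
  ('E_P[addZ X B k] = 'E_P[X] + k%:E * 'E_P[B])%E.
Proof.
have Pfin : P setT \is a fin_num := fin_num_measure P _ measurableT.
move=> X2 B2; have X1 := Lfun_subset12 Pfin X2; have B1 := Lfun_subset12 Pfin B2.
rewrite addZ_fun expectationD //; last by rewrite Lfun_scale.
by rewrite expectationZl.
Qed.

Lemma covariance_addZ X Y B k xy xb byy bb :
  (X : T -> R) \in Lfun P 2%:E -> (Y : T -> R) \in Lfun P 2%:E ->
  (B : T -> R) \in Lfun P 2%:E ->
  covariance P X Y = xy%:E -> covariance P X B = xb%:E ->
  covariance P B Y = byy%:E -> covariance P B B = bb%:E ->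
  covariance P (addZ X B k) (addZ Y B k) =
  (xy + k * xb + k * byy + k ^+ 2 * bb)%:E.
Proof.
have Pfin : P setT \is a fin_num := fin_num_measure P _ measurableT.
move=> X2 Y2 B2 Exy Exb Eby Ebb.
have X1 := Lfun_subset12 Pfin X2; have B1 := Lfun_subset12 Pfin B2.
have Y1 := Lfun_subset12 Pfin Y2.
have kB2 : k \o* (B : T -> R) \in Lfun P 2%:E by rewrite Lfun_scale // ler1n.
have kB1 := Lfun_subset12 Pfin kB2.
have YB2 : ((Y : T -> R) \+ k \o* (B : T -> R)) \in Lfun P 2%:E.
  by rewrite -[_ \+ _]/((Y : T -> R) + _); apply: rpredD => *; rewrite ?lee1n.
rewrite !addZ_fun covarianceDl // !covarianceDr //.
have c1 := covarianceZr k X1 B1 (Lfun2_mul_Lfun1 X2 B2).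
have c2 := covarianceZl k B1 Y1 (Lfun2_mul_Lfun1 B2 Y2).
have c3 := covarianceZr k kB1 B1 (Lfun2_mul_Lfun1 kB2 B2).
have c4 := covarianceZl k B1 B1 (Lfun2_mul_Lfun1 B2 B2).
rewrite c1 c2 c3 c4 Exy Exb Eby Ebb -!EFinM -!EFinD; congr (_%:E); ring.
Qed.

End Moments.

Section Transfer.
Context {R : realType} (m : nat) (G G' : mgraph R).
Variables (phi : gpoint G -> gpoint G') (psi : gpoint G' -> gpoint G).
Variables (z : gpoint G) (b : R).
Hypothesis phiK : cancel phi psi.
Hypothesis psiK : cancel psi phi.
Hypothesis smooth_phi : forall f : gpoint G' -> R,
  smooth m (f \o phi) <-> smooth m f.
Hypothesis inner_phi : forall f g : gpoint G' -> R, smooth m f -> smooth m g ->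
  innerF m.+1 (f \o phi) (g \o phi) = innerF m.+1 f g.
(* The graphs have the same vertices up to one, which is the only obstruction
   to the equality of the normalizations [\sum_v f v = 0]. *)
Hypothesis sum_psi : forall f : gpoint G -> R,
  \sum_(v < nv G') f (psi (inl v)) = \sum_(v < nv G) f (inl v) + b * f z.

Let n' : R := (nv G')%:R.
Let n'0 : n' != 0. Proof. by rewrite pnatr_eq0 -lt0n nv_gt0. Qed.

(* With c = - b / n', subtracting from f its mean over the vertices of G'
   amounts, for f of zero mean over those of G, to adding c f(z). *)
Let c := - (b / n').

Let sum_cst (G1 : mgraph R) (r : R) : \sum_(v < nv G1) r = (nv G1)%:R * r.
Proof. by rewrite sumr_const card_ord mulr_natl. Qed.

(** The formula is the covariance of [Z (psi x) + c * Z z] when Z has covariance k. For f normalized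
    on G', with K the mean of [f \o phi] over the vertices of G, pairing with it gives
    [f x - K + c * (f (phi z) - K)], and the normalization of f says that the terms other than [f x]
    cancel. *)
Lemma transfer_kernel k : reproducing_kernel m.+1 k ->
  reproducing_kernel m.+1 (fun x y : gpoint G' =>
    k (psi x) (psi y) + c * k (psi x) z + c * k z (psi y) + c ^+ 2 * k z z).
Proof.
move=> kP.
have ks x : smooth m (k x) by have [/in_F_smooth[]] := kP x.
have ksum x : \sum_v k x (inl v) = 0 by have [/in_F_smooth[]] := kP x.
move=> x; set k' := (X in in_F _ X).
(* The last summand does not depend on y, so the inner product kills it. *)
have k'E : k' \o phi = fun y => (k (psi x) y + c * k z y) +
    (c * k (psi x) z + c ^+ 2 * k z z) * 1.
  by apply/funext => y; rewrite /k' /= phiK; ring.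
have s1 := smooth_cst m G (1 : R).
have s2 := smoothD c (ks (psi x)) (ks z).
have sk' : smooth m k' by apply/smooth_phi; rewrite k'E; exact: smoothD.
split.
  apply/in_F_smooth; split => //.
  have -> : \sum_(v < nv G') k' (inl v) =
      \sum_(v < nv G') (k (psi x) (psi (inl v)) + c * k z (psi (inl v)) +
      (c * k (psi x) z + c ^+ 2 * k z z)).
    by apply: eq_bigr => v _; rewrite /k'; ring.
  rewrite !big_split /= -mulr_sumr !sum_psi !ksum !sum_cst -/n' /c.
  by field.
move=> f /in_F_smooth[sf fsum].
have sfp : smooth m (f \o phi) by apply/smooth_phi.
rewrite -inner_phi // k'E !innerFDr // innerF_cst // mulr0 addr0.
pose n : R := (nv G)%:R.
have n0 : n != 0 by rewrite pnatr_eq0 -lt0n nv_gt0.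
(* The kernel k reproduces only normalized functions, so [f \o phi] is first centered on the
   vertices of G. *)
pose K := (\sum_v f (phi (inl v))) / n.
pose f0 := fun y => f (phi y) + - K * 1.
have sf0 : smooth m f0 by exact: smoothD.
have F0 : in_F m.+1 f0.
  apply/in_F_smooth; split => //.
  by rewrite big_split /= sum_cst -/n mulr1 mulrN mulrC mulfVK // subrr.
have rep y : innerF m.+1 (f \o phi) (k y) = f (phi y) - K.
  rewrite (_ : f \o phi = fun y => f0 y + K * 1); last first.
    by apply/funext => w; rewrite /f0 /=; ring.
  rewrite innerFC innerFDr // innerF_cst // mulr0 addr0 innerFC.
  by rewrite (proj2 (kP y) f0 F0) /f0; ring.
rewrite !rep psiK.
have KE : K * n' = - (b * (f (phi z) - K)).
  have := sum_psi f0; have [_ ->] := (in_F_smooth m f0).1 F0.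
  rewrite /f0 big_split /= sum_cst -/n' mulr1.
  under eq_bigr do rewrite psiK.
  by rewrite fsum => ?; lra.
have <- : K = c * (f (phi z) - K).
  by apply: (mulIf n'0); rewrite KE /c; field.
by ring.
Qed.

Lemma transfer_is_variogram (gam : gpoint G -> gpoint G -> R) :
  is_variogram m.+1 gam ->
  is_variogram m.+1 (fun x y => gam (psi x) (psi y)).
Proof.
case=> d [T [P [Z [[gZ EZ [k kP cov]] V]]]].
have L2 x : (Z x : T -> R) \in Lfun P 2%:E := centered_Lfun2 (EZ x) (cov x x).
exists d, T, P, (fun x => addZ (Z (psi x)) (Z z) c); split; last first.
  move=> x1 x2; rewrite -V; congr variance; apply/funext => w.
  by rewrite /=; ring.
split.
- move=> n a x.
  (* A combination of n values of the new process is one of n + 1 values of Z, where index 0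
     collects all the copies of [c * Z z]. *)
  pose a' (i : 'I_n.+1) := if unlift ord0 i is Some j then a j
    else c * \sum_(j < n) a j.
  pose x' (i : 'I_n.+1) := if unlift ord0 i is Some j then psi (x j) else z.
  have := gZ n.+1 a' x'; congr gaussian; apply/funext => w.
  rewrite big_ord_recl /a' /x' /= unlift_none.
  under [X in _ + X = _] eq_bigr do rewrite liftK.
  under [RHS]eq_bigr do rewrite mulrDr.
  rewrite big_split /= addrC; congr (_ + _).
  rewrite mulr_sumr mulr_suml.
  by apply: eq_bigr => j _; ring.
- by move=> x; rewrite expectation_addZ // !EZ mule0 adde0.
- eexists; first exact: transfer_kernel kP.
  move=> x y; exact: covariance_addZ (cov _ _) (cov _ _) (cov _ _) (cov _ _).
Qed.

End Transfer.

Section TransferVariogram.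
Context {R : realType} (m : nat) (G G' : mgraph R).
Variables (phi : gpoint G -> gpoint G') (psi : gpoint G' -> gpoint G).
Variables (z : gpoint G) (b : R).
Hypothesis phiK : cancel phi psi.
Hypothesis psiK : cancel psi phi.
Hypothesis smooth_phi : forall f : gpoint G' -> R,
  smooth m (f \o phi) <-> smooth m f.
Hypothesis inner_phi : forall f g : gpoint G' -> R, smooth m f -> smooth m g ->
  innerF m.+1 (f \o phi) (g \o phi) = innerF m.+1 f g.
Hypothesis sum_psi : forall f : gpoint G -> R,
  \sum_(v < nv G') f (psi (inl v)) = \sum_(v < nv G) f (inl v) + b * f z.

(** If either graph has a variogram, so does the other, and uniqueness identifies them; otherwise
    both sides are the default 0. This is why the inverse transfer is needed too. *)
Lemma transfer_variogram x1 x2 :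
  variogram m.+1 (phi x1) (phi x2) = variogram m.+1 x1 x2.
Proof.
have T gam := transfer_is_variogram phiK psiK smooth_phi inner_phi sum_psi
  (gam := gam).
have phipsi (f : gpoint G -> R) : (f \o psi) \o phi = f.
  by apply/funext => y; rewrite /= phiK.
have smooth_psi (f : gpoint G -> R) : smooth m (f \o psi) <-> smooth m f.
  by rewrite -smooth_phi phipsi.
have inner_psi (f g : gpoint G -> R) : smooth m f -> smooth m g ->
    innerF m.+1 (f \o psi) (g \o psi) = innerF m.+1 f g.
  by move=> sf sg; rewrite -inner_phi ?phipsi //; apply/smooth_psi.
(* Exchanging the two graphs turns [z] into [phi z] and [b] into [- b]. *)
have sum_phi (f : gpoint G' -> R) :
    \sum_(v < nv G) f (phi (inl v)) = \sum_(v < nv G') f (inl v) + - b * f (phi z).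
  rewrite mulNr; apply/esym/eqP; rewrite subr_eq -(sum_psi (f \o phi)).
  by apply/eqP/eq_bigr => v _ /=; rewrite psiK.
have S gam := transfer_is_variogram psiK phiK smooth_psi inner_psi sum_phi
  (gam := gam).
rewrite /variogram; have [[gam g]|N] := pselect (exists gam, @is_variogram R m.+1 G gam).
  rewrite (xget_unique _ g); last by move=> y yP; exact: is_variogram_unique yP g.
  rewrite (xget_unique _ (T _ g)); last by move=> y yP; exact: is_variogram_unique yP (T _ g).
  by rewrite /= !phiK.
rewrite !xgetPN // => gam g; first by apply: N; exists gam.
by apply: N; eexists; exact: S g.
Qed.

End TransferVariogram.

(** * Isomorphisms of metric graphs *)

Section PointLemmas.
Context {R : realType} (G : mgraph R).
Implicit Types (e : edge G) (t : R).

Lemma pt_inr e t (H : 0 < t < len e) :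
  pt e t = inr (exist (fun et : edge G * R => 0 < et.2 < len et.1) (e, t) H).
Proof.
rewrite /pt; case: insubP => [u _ uE|]; last by rewrite /= H.
by congr inr; apply: val_inj.
Qed.

Lemma inr_pt (u : {et : edge G * R | 0 < et.2 < len et.1}) :
  inr u = pt (val u).1 (val u).2.
Proof. by case: u => -[e t] H; rewrite /= pt_inr. Qed.

Lemma pt_le0 e t : t <= 0 -> pt e t = inl (src e).
Proof.
move=> t0; rewrite /pt; case: insubP => [u|_] /=; last by rewrite t0.
by rewrite ltNge t0.
Qed.

Lemma pt_ge_len e t : len e <= t -> pt e t = inl (tgt e).
Proof.
move=> tl; rewrite /pt; case: insubP => [u|_] /=.
  by rewrite andbC ltNge tl.
by rewrite leNgt (lt_le_trans (len_gt0 e) tl).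
Qed.

End PointLemmas.

Section Isomorphism.
Context {R : realType} (m : nat) (G G' : mgraph R).
Variables (phi : gpoint G -> gpoint G') (nu : 'I_(nv G) -> 'I_(nv G')).
Variables (eta : edge G -> edge G') (flip : pred (edge G)).
Hypothesis nu_bij : bijective nu.
Hypothesis eta_bij : bijective eta.
Let sig e t := if flip e then len e - t else t.
Hypothesis len_eta : forall e, len (eta e) = len e.
Hypothesis src_eta : forall e, src (eta e) = nu (if flip e then tgt e else src e).
Hypothesis tgt_eta : forall e, tgt (eta e) = nu (if flip e then src e else tgt e).
Hypothesis phi_inl : forall v, phi (inl v) = inl (nu v).
Hypothesis phi_inr : forall u, phi (inr u) =
  pt (eta (val u).1) (sig (val u).1 (val u).2).

Let sigK e t : sig e (sig e t) = t.
Proof. by rewrite /sig; case: (flip e) => //; rewrite subKr. Qed.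

Let sig_in e t : (0 < sig e t < len e) = (0 < t < len e).
Proof. by rewrite /sig; case: (flip e) => //; apply/idP/idP; lra. Qed.

(** This covers all real t: beyond the edge [pt] is clamped to an end, and a flip exchanges the ends
    just as [sig] exchanges t <= 0 and t >= len e. *)
Lemma iso_pt e t : phi (pt e t) = pt (eta e) (sig e t).
Proof.
have [t0|t0] := leP t 0.
  rewrite pt_le0 // phi_inl /sig; have := src_eta e; have := tgt_eta e.
  case: (flip e) => [<- _|_ <-]; last by rewrite pt_le0.
  by rewrite pt_ge_len // len_eta; lra.
have [tl|tl] := leP (len e) t.
  rewrite pt_ge_len // phi_inl /sig; have := src_eta e; have := tgt_eta e.
  case: (flip e) => [_ <-|<- _]; last by rewrite pt_ge_len ?len_eta.
  by rewrite pt_le0 //; lra.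
have H : 0 < t < len e by rewrite t0.
by rewrite (pt_inr H) phi_inr.
Qed.

Lemma iso_bij : bijective phi.
Proof.
case: nu_bij => nu' nuK nu'K; case: eta_bij => eta' etaK eta'K.
pose psi (y : gpoint G') : gpoint G := match y with
  | inl v => inl (nu' v)
  | inr u => pt (eta' (val u).1) (sig (eta' (val u).1) (val u).2) end.
have psi_pt e t : 0 < t < len e -> psi (pt (eta e) t) = pt e (sig e t).
  by move=> H; rewrite pt_inr ?len_eta //= etaK.
exists psi => [[v|u]|[v|u]].
- by rewrite phi_inl /= nuK.
- rewrite inr_pt iso_pt psi_pt ?sigK // sig_in; exact: valP u.
- by rewrite phi_inl nu'K.
- rewrite inr_pt -{1}[(val u).1]eta'K psi_pt.
    by rewrite iso_pt sigK eta'K.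
  by rewrite -len_eta eta'K; exact: valP u.
Qed.

Let incident_iso v e : incident (nu v) (eta e) = incident v e.
Proof.
have I := inj_eq (bij_inj nu_bij).
rewrite /incident src_eta tgt_eta !I; case: (flip e) => //; exact: orbC.
Qed.

(** Incidence matters: at a vertex off e, [exit_pt] starts by default from the target, which a flip
    changes. *)
Lemma iso_exit_pt e v h : incident v e ->
  phi (exit_pt e v h) = exit_pt (eta e) (nu v) h.
Proof.
have I := inj_eq (bij_inj nu_bij).
have [sv|sv] := eqVneq (src e) v; rewrite /incident /exit_pt.
  rewrite sv eqxx => _; rewrite iso_pt src_eta I /sig len_eta.
  by case: (flip e); rewrite ?sv ?eqxx // -sv eq_sym (negbTE (no_loop e)).
rewrite (negbTE sv) /= => /eqP tv; rewrite iso_pt src_eta I /sig len_eta.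
by case: (flip e); rewrite ?tv ?eqxx ?(negbTE sv) // subKr.
Qed.

Let on_edge_iso f e : on_edge (f \o phi) e =
  (fun t => on_edge f (eta e) (sig e t)).
Proof. by apply/funext => t; rewrite /on_edge /= iso_pt. Qed.

Let N1 : (-1 : R) = 1 \/ (-1 : R) = -1. Proof. by right. Qed.

Let refl_seg (l y : R) : (0 <= y <= l) = (0 <= l + -1 * y <= l).
Proof. by apply/idP/idP; lra. Qed.

Let sobolev_sig e g : sobolev (len e) m g ->
  sobolev (len e) m (fun t => g (sig e t)).
Proof.
move=> /(sobolev_tower (len_gt0 e))[h T].
have := tower_sobolev (len_gt0 e) (tower_aff N1 (refl_seg _) T).
have := tower_sobolev (len_gt0 e) T.
rewrite /sig; case: (flip e) => // _; congr sobolev.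
by apply/funext => t; rewrite mulN1r.
Qed.

Let exit_deriv_iso i f e v : incident v e ->
  exit_deriv i (f \o phi) e v = exit_deriv i f (eta e) (nu v).
Proof.
move=> ve; rewrite /exit_deriv len_eta; congr derivn_on.
by apply/funext => h /=; rewrite iso_exit_pt.
Qed.

Let kirchhoff_iso i f v : kirchhoff i (f \o phi) v <-> kirchhoff i f (nu v).
Proof.
rewrite /kirchhoff; case: (odd i).
  rewrite [X in _ <-> X = _](reindex eta (onW_bij _ eta_bij)) //=.
  rewrite [X in _ <-> X = _](eq_bigl (incident v)); last first.
    by move=> e; exact: incident_iso.
  by rewrite (eq_bigr _ (fun e ve => exit_deriv_iso i f ve)).
case: (eta_bij) => eta' etaK eta'K.
split=> H e e' ve ve'.
  move: ve ve'; rewrite -(eta'K e) -(eta'K e') !incident_iso => ve ve'.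
  by rewrite -!exit_deriv_iso // (H _ _ ve ve').
by rewrite !exit_deriv_iso // (H (eta e) (eta e')) // incident_iso.
Qed.

Lemma iso_smooth f : smooth m (f \o phi) <-> smooth m f.
Proof.
case: (nu_bij) (eta_bij) => nu' _ nu'K [eta' _ eta'K].
split=> -[H K]; split=> [e|v i im].
- rewrite -(eta'K e) len_eta; have := sobolev_sig (H (eta' e)).
  by congr sobolev; apply/funext => t; rewrite on_edge_iso sigK.
- by rewrite -(nu'K v); apply/kirchhoff_iso/K.
- by rewrite on_edge_iso; apply: sobolev_sig; rewrite -len_eta.
- exact/kirchhoff_iso/K.
Qed.

Lemma iso_innerF f g : smooth m f -> smooth m g ->
  innerF m.+1 (f \o phi) (g \o phi) = innerF m.+1 f g.
Proof.
move=> sf sg; rewrite /innerF [RHS](reindex eta (onW_bij _ eta_bij)).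
apply: eq_bigr => e _; rewrite !on_edge_iso len_eta.
have [h T] := smooth_tower (eta e) sf; have [h' T'] := smooth_tower (eta e) sg.
rewrite len_eta in T T'.
rewrite (pairing_tower (len_gt0 e) T T') /sig.
case: (flip e); last exact: pairing_tower (len_gt0 e) T T'.
have refl (u : R -> R) F w : tower 0 (len e) m u F w ->
    tower 0 (len e) m (fun t => u (len e - t)) _ _ :=
  fun S => eq_tower (fun x _ => congr1 (fun y => u (len e + y)) (mulN1r x))
    (tower_aff N1 (refl_seg (len e)) S).
rewrite (pairing_tower (len_gt0 e) (refl _ _ _ T) (refl _ _ _ T')).
apply: pairing_aff => //; [|exact: tower_sq T|exact: tower_sq T'].
by rewrite -expr2 sqrr_sign.
Qed.

Lemma iso_variogram x1 x2 :
  variogram m.+1 (phi x1) (phi x2) = variogram m.+1 x1 x2.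
Proof.
have [psi phiK psiK] := iso_bij.
(* The vertices correspond, so there is no extra term; [z] is any available point. *)
apply: (transfer_variogram (z := inl (Ordinal (nv_gt0 G))) (b := 0) phiK psiK).
- exact: iso_smooth.
- exact: iso_innerF.
- move=> f; rewrite mul0r addr0 (reindex nu (onW_bij _ nu_bij)) //=.
  by apply: eq_bigr => v _; rewrite -phi_inl phiK.
Qed.

End Isomorphism.

Section Instances.
Context {R : realType} (m : nat) (G : mgraph R).

Lemma variogram_reorder (s : 'S_(nv G)) (x1 x2 : gpoint G) :
  variogram m.+1 (reorder_pt s x1) (reorder_pt s x2) = variogram m.+1 x1 x2.
Proof.
apply: (@iso_variogram _ m G (reorder s) (@reorder_pt R G s) s id xpred0) => //.
- by exists (perm.perm_inv s)%g; [exact: permK|exact: permKV].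
- by exists id.
- by move=> u; exact: (@inr_pt _ (reorder s)).
Qed.

Lemma variogram_relabel (E : finType) (h : E -> edge G) (hbij : bijective h)
    (x1 x2 : gpoint (relabel hbij)) :
  variogram m.+1 (relabel_pt x1) (relabel_pt x2) = variogram m.+1 x1 x2.
Proof.
apply: (@iso_variogram _ m (relabel hbij) G (@relabel_pt R G E h hbij) id h
  xpred0) => //.
by exists id.
Qed.

Lemma variogram_reorient (flip : pred (edge G)) (x1 x2 : gpoint G) :
  variogram m.+1 (reorient_pt flip x1) (reorient_pt flip x2) =
  variogram m.+1 x1 x2.
Proof.
apply: (@iso_variogram _ m G (reorient flip) (@reorient_pt R G flip) id id
  flip) => //.
- by exists id.
- by exists id.
- by case=> -[e t] H; exact: erefl.
Qed.

End Instances.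

(** * Splitting an edge *)

Lemma tower_shift {R : realType} (a b a' b' c : R) m g F h :
  (forall y, (a' <= y <= b') = (a <= c + y <= b)) -> tower a b m g F h ->
  tower a' b' m (fun x => g (c + x)) (fun i x => F i (c + x))
    (fun x => h (c + x)).
Proof.
move=> ab T.
have ab1 y : (a' <= y <= b') = (a <= c + 1 * y <= b) by rewrite mul1r ab.
have := tower_aff (or_introl (erefl 1)) ab1 T.
congr tower; [|apply/funext => i|]; apply/funext => x; rewrite ?expr1n !mul1r //.
Qed.

Section SplitEdge.
Context {R : realType} (m : nat) (G : mgraph R) (e0 : edge G) (s : R)
  (hs : 0 < s < len e0).
Local Notation G' := (split_edge hs).
Local Notation phi := (split_pt hs).
Local Notation L := (len e0).
Let old (v : 'I_(nv G)) : 'I_(nv G') := widen_ord (leqnSn _) v.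
Let new : 'I_(nv G') := @ord_max (nv G).
Let e1 : edge G' := Some e0.
Let e2 : edge G' := None.

Let len1 : len e1 = s. Proof. by rewrite /len /= eqxx. Qed.
Let len2 : len e2 = L - s. Proof. by []. Qed.
Let src1 : src e1 = old (src e0). Proof. by []. Qed.
Let tgt1 : tgt e1 = new. Proof. by rewrite /tgt /= eqxx. Qed.
Let src2 : src e2 = new. Proof. by []. Qed.
Let tgt2 : tgt e2 = old (tgt e0). Proof. by []. Qed.
Let len_some e : e != e0 -> len (Some e : edge G') = len e.
Proof. by rewrite /len /= => /negbTE ->. Qed.
Let src_some e : src (Some e : edge G') = old (src e). Proof. by []. Qed.
Let tgt_some e : e != e0 -> tgt (Some e : edge G') = old (tgt e).
Proof. by rewrite /tgt /= => /negbTE ->. Qed.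

Let old_eq u v : (old u == old v) = (u == v). Proof. by []. Qed.
Let old_new v : (old v == new) = false.
Proof. by apply/negbTE; rewrite -val_eqE /= neq_ltn ltn_ord. Qed.
Let new_old v : (new == old v) = false. Proof. by rewrite eq_sym old_new. Qed.
Let lift_old v : lift new v = old v.
Proof. by apply: val_inj; exact: lift_max. Qed.

Lemma split_pt_other e t : e != e0 -> phi (pt e t) = @pt R G' (Some e) t.
Proof.
move=> ne.
have [t0|t0] := leP t 0; first by rewrite !pt_le0.
have [tl|tl] := leP (len e) t.
  by rewrite !pt_ge_len ?len_some // tgt_some.
have H : 0 < t < len e by rewrite t0.
by rewrite (pt_inr H) /= (negbTE ne).
Qed.

Lemma split_pt_left t : t <= s -> phi (pt e0 t) = pt e1 t.
Proof.
have /andP[s0 sL] := hs.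
move=> ts; have [t0|t0] := leP t 0; first by rewrite !pt_le0.
have H : 0 < t < L by lra.
by rewrite (pt_inr H) /= eqxx ltNge ts.
Qed.

(** At t = s both halves give the new vertex, by clamping at the end of [e1] and at the start of
    [e2]. *)
Lemma split_pt_right t : s <= t -> phi (pt e0 t) = pt e2 (t - s).
Proof.
have /andP[s0 sL] := hs.
rewrite le_eqVlt => /predU1P[<-|st].
  by rewrite split_pt_left // subrr pt_ge_len ?len1 // pt_le0 // tgt1.
have [tl|tl] := leP L t.
  by rewrite !pt_ge_len // len2; lra.
have H : 0 < t < L by lra.
by rewrite (pt_inr H) /= eqxx st.
Qed.

Lemma split_ptK : cancel phi (@merge_pt R G e0 s hs).
Proof.
have /andP[s0 sL] := hs.
have M1 e t : 0 < t < len (Some e : edge G') ->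
    merge_pt (pt (Some e : edge G') t) = pt e t.
  by move=> H; rewrite pt_inr.
have M2 t : 0 < t < len e2 -> merge_pt (pt e2 t) = pt e0 (s + t).
  by move=> H; rewrite pt_inr.
case=> [v|u]; first by rewrite /= -[widen_ord _ _]/(old v) -lift_old liftK.
rewrite inr_pt; have := valP u; case: (val u) => e t /= te.
have [ee|ne] := eqVneq e e0; last first.
  by rewrite split_pt_other // M1 // len_some.
rewrite {}ee in te *; case: (ltgtP t s) => ts.
- by rewrite split_pt_left ?ltW // M1 // len1; lra.
- rewrite split_pt_right ?ltW // M2 ?len2; last by lra.
  by congr pt; ring.
- by rewrite split_pt_left ?ts // pt_ge_len ?len1 // tgt1 /= unlift_none.
Qed.

Lemma merge_ptK : cancel (@merge_pt R G e0 s hs) phi.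
Proof.
have /andP[s0 sL] := hs.
case=> [v|u].
  rewrite /=; case: unliftP => [w ->|->]; first by rewrite lift_old.
  by rewrite split_pt_left // pt_ge_len ?len1 // tgt1.
rewrite inr_pt; have := valP u; case: (val u) => -[e|] t /= te.
  rewrite [in LHS](pt_inr (e := Some e : edge G') te) /=.
  have [ee|ne] := eqVneq e e0; last exact: split_pt_other.
  by rewrite {}ee in te *; rewrite split_pt_left //; move: te; rewrite eqxx; lra.
rewrite [in LHS](pt_inr (e := e2) te) /= split_pt_right; last by lra.
by congr pt; ring.
Qed.

Section OnEdge.
Variable f : gpoint G' -> R.
Let g := on_edge (f \o phi) e0.
Let g1 := on_edge f e1.
Let g2 := on_edge f e2.

Lemma on_edge_split_other e : e != e0 ->
  on_edge (f \o phi) e = on_edge f (Some e : edge G').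
Proof. by move=> ne; apply/funext => t; rewrite /on_edge /= split_pt_other. Qed.

Lemma tower_split_left F h : tower 0 L m g F h -> tower 0 (len e1) m g1 F h.
Proof.
have /andP[s0 sL] := hs.
move=> T; rewrite len1; apply: (@eq_tower _ _ _ _ g).
  by move=> x /andP[_ xs]; rewrite /g /on_edge /= split_pt_left.
by apply: tower_sub T => //; lra.
Qed.

Lemma tower_split_right F h : tower 0 L m g F h ->
  tower 0 (len e2) m g2 (fun i x => F i (s + x)) (fun x => h (s + x)).
Proof.
have /andP[s0 sL] := hs.
move=> T; rewrite len2; apply: (@eq_tower _ _ _ _ (fun x => g (s + x))).
  move=> x x0; rewrite /g /on_edge /= split_pt_right; last by lra.
  by rewrite addrC addKr.
have T' : tower s L m g F h by apply: tower_sub T => //; lra.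
by apply: tower_shift T' => y; apply/idP/idP; lra.
Qed.

Lemma tower_merge F1 F2 h1 h2 : tower 0 (len e1) m g1 F1 h1 ->
  tower 0 (len e2) m g2 F2 h2 ->
  (forall i, (i <= m)%N -> F1 i s = F2 i 0) ->
  exists F h, tower 0 L m g F h.
Proof.
have /andP[s0 sL] := hs.
rewrite len1 len2 => T1 T2 E.
have T1' : tower 0 s m g F1 h1.
  apply: eq_tower T1 => x /andP[_ xs].
  by rewrite /g /on_edge /= split_pt_left.
have T2' : tower s L m g (fun i x => F2 i (- s + x)) (fun x => h2 (- s + x)).
  apply: (@eq_tower _ _ _ _ (fun x => g2 (- s + x))).
    by move=> x /andP[sx _]; rewrite /g /on_edge /= split_pt_right // addrC.
  by apply: tower_shift T2 => y; apply/idP/idP; lra.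
do 2 eexists; apply: tower_cat T1' T2'; first by lra.
by move=> i im; rewrite E // addNr.
Qed.

Let incident_new e' : incident new e' = (e' == e1) || (e' == e2).
Proof.
rewrite /incident; case: e' => [e|]; last by rewrite src2 eqxx orbT.
rewrite src_some old_new orbF /=; have [->|ne] := eqVneq e e0.
  by rewrite !eqxx.
rewrite -[widen_ord _ _]/(old (tgt e)) old_new; apply/esym/negbTE.
by apply: contraNneq ne => -[->].
Qed.

(** With two edges at the vertex, the sign absorbs the parity. As [e1] is left through its target,
    its exit derivative carries the same sign, and what remains is the matching condition of
    [tower_merge]. *)
Lemma kirchhoff_new i : kirchhoff i f new <->
  exit_deriv i f e1 new = (-1) ^+ i * exit_deriv i f e2 new.
Proof.
rewrite /kirchhoff -signr_odd; case: (odd i).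
  rewrite (bigD1 e1) ?incident_new ?eqxx //= (bigD1 e2) /=; last first.
    by rewrite incident_new eqxx orbT.
  rewrite big1 ?addr0 => [|e']; last first.
    by rewrite incident_new; case/andP=> /andP[/orP[]->].
  by rewrite expr1 mulN1r; split=> [/eqP|->]; rewrite ?addNr // addr_eq0 => /eqP.
rewrite mul1r; split=> [H|H e e'].
  by apply: H; rewrite incident_new eqxx ?orbT.
by rewrite !incident_new => /orP[]/eqP-> /orP[]/eqP->.
Qed.

Lemma exit_deriv_new1 i F h : (i <= m)%N -> tower 0 (len e1) m g1 F h ->
  exit_deriv i f e1 new = (-1) ^+ i * F i s.
Proof.
by move=> im T; rewrite (exit_deriv_tower new im T) src1 old_new len1.
Qed.

Lemma exit_deriv_new2 i F h : (i <= m)%N -> tower 0 (len e2) m g2 F h ->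
  exit_deriv i f e2 new = F i 0.
Proof. by move=> im T; rewrite (exit_deriv_tower new im T) src2 eqxx. Qed.

(** On the edges incident to v this is a bijection onto those incident to [old v]: [e0] goes to its
    half that touches v. It depends on v because the two ends of [e0] see different halves. *)
Let rho (v : 'I_(nv G)) (e : edge G) : edge G' :=
  if (e == e0) && (tgt e0 == v) then e2 else Some e.
Let rho' (e' : edge G') : edge G := odflt e0 e'.

Let rhoK v : cancel (rho v) rho'.
Proof. by move=> e; rewrite /rho; case: ifP => // /andP[/eqP-> _]. Qed.

Let rho'K v e' : incident (old v) e' -> rho v (rho' e') = e'.
Proof.
rewrite /incident /rho; case: e' => [e|]; last first.
  by rewrite src2 tgt2 new_old old_eq /= eqxx => ->.
rewrite src_some old_eq [rho' _]/=; have [->|//] := eqVneq e e0.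
rewrite -/e1 tgt1 new_old orbF => /eqP <-.
by rewrite eq_sym (negbTE (no_loop e0)).
Qed.

Let incident_rho v e : incident (old v) (rho v e) = incident v e.
Proof.
rewrite /incident /rho; have [->|ne] := eqVneq e e0; last first.
  by rewrite src_some tgt_some // !old_eq.
have [tv|tv] := eqVneq (tgt e0) v.
  by rewrite andbT src2 tgt2 old_eq tv eqxx !orbT.
by rewrite andbF -/e1 src1 tgt1 old_eq new_old.
Qed.

(** For [e0] the two exit derivatives are limits over segments of different lengths; read off one
    tower of the whole edge, they are the same end value. *)
Lemma exit_deriv_rho i F h v e : (i <= m)%N -> tower 0 L m g F h ->
  incident v e -> exit_deriv i f (rho v e) (old v) = exit_deriv i (f \o phi) e v.
Proof.
move=> im T ve; rewrite /rho; have [ee|ne] := eqVneq e e0; last first.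
  rewrite /= /exit_deriv len_some //; congr derivn_on.
  apply/funext => t; rewrite /exit_pt src_some old_eq len_some //.
  by case: ifP => _; rewrite -split_pt_other //; case: ifP.
rewrite {}ee in ve *; rewrite (exit_deriv_tower v im T).
have [tv|tv] := eqVneq (tgt e0) v.
  rewrite andbT (exit_deriv_tower (old v) im (tower_split_right T)).
  rewrite src2 new_old -tv (negbTE (no_loop e0)).
  by rewrite len2 addrCA subrr addr0.
rewrite andbF -/e1 (exit_deriv_tower (old v) im (tower_split_left T)).
rewrite src1 old_eq; move: ve; rewrite /incident (negbTE tv) orbF => ->.
by [].
Qed.

Lemma kirchhoff_old i F h v : (i <= m)%N -> tower 0 L m g F h ->
  kirchhoff i f (old v) <-> kirchhoff i (f \o phi) v.
Proof.
move=> im T; rewrite /kirchhoff; case: (odd i).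
  rewrite [X in X = _ <-> _](reindex_onto (rho v) rho'); last exact: rho'K.
  rewrite [X in X = _ <-> _](eq_bigl (incident v)); last first.
    by move=> e; rewrite rhoK eqxx andbT incident_rho.
  by rewrite (eq_bigr _ (fun e ve => exit_deriv_rho im T ve)).
split=> H e e' ve ve'.
  by rewrite -!(exit_deriv_rho im T) // (H _ (rho v e')) ?incident_rho.
rewrite -(rho'K ve) -(rho'K ve') !(exit_deriv_rho im T) ?(H _ (rho' e')) //.
all: by rewrite -incident_rho rho'K.
Qed.

Lemma split_smooth : smooth m (f \o phi) <-> smooth m f.
Proof.
split=> sf.
  have [h T] := smooth_tower e0 sf.
  split=> [[e|]|v i im].
  - have [->|ne] := eqVneq e e0.
      exact: tower_sobolev (len_gt0 e1) (tower_split_left T).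
    by rewrite -on_edge_split_other // len_some //; exact: sf.1.
  - exact: tower_sobolev (len_gt0 e2) (tower_split_right T).
  - case: (unliftP new v) => [w ->|->].
      by rewrite lift_old; apply/(kirchhoff_old _ im T)/sf.2.
    apply/kirchhoff_new; rewrite (exit_deriv_new1 im (tower_split_left T)).
    by rewrite (exit_deriv_new2 im (tower_split_right T)) addr0.
have [h1 T1] := smooth_tower e1 sf; have [h2 T2] := smooth_tower e2 sf.
(* The conditions at the new vertex come first: they give the tower on the whole edge that
   [kirchhoff_old] requires. *)
have [|F [h T]] := tower_merge T1 T2.
  move=> i im; have := (kirchhoff_new i).1 (sf.2 new i im).
  rewrite (exit_deriv_new1 im T1) (exit_deriv_new2 im T2).
  by apply: mulfI; rewrite signr_eq0.
split=> [e|v i im]; last by apply/(kirchhoff_old _ im T)/sf.2.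
have [->|ne] := eqVneq e e0; first exact: tower_sobolev (len_gt0 e0) T.
by rewrite on_edge_split_other // -len_some //; exact: sf.1.
Qed.

End OnEdge.

Lemma split_innerF (f g : gpoint G' -> R) : smooth m f -> smooth m g ->
  innerF m.+1 (f \o phi) (g \o phi) = innerF m.+1 f g.
Proof.
have /andP[s0 sL] := hs.
move=> /split_smooth sf /split_smooth sg.
have [h T] := smooth_tower e0 sf; have [h' T'] := smooth_tower e0 sg.
rewrite /innerF (bigD1 e0) // [RHS](bigD1 e2) // [X in _ = _ + X](bigD1 e1) //.
rewrite [RHS]addrA; congr (_ + _).
  rewrite (pairing_tower (len_gt0 e0) T T').
  rewrite (pairing_tower (len_gt0 e1) (tower_split_left T) (tower_split_left T')).
  rewrite (pairing_tower (len_gt0 e2) (tower_split_right T) (tower_split_right T')).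
  rewrite (@pairing_cat _ _ s _ _ _ _ (tower_sq T) (tower_sq T')); last by lra.
  rewrite len1 len2 addrC; congr (_ + _).
  have sub w : sq_integrable 0 L w -> sq_integrable s L w.
    by apply: sq_integrable_sub => //; lra.
  have ab (y : R) : (0 <= y <= L - s) = (s <= s + 1 * y <= L).
    by apply/idP/idP; lra.
  rewrite -(pairing_aff (or_introl (erefl 1)) (mulr1 1) ab
    (sub _ (tower_sq T)) (sub _ (tower_sq T'))).
  by congr pairing; apply/funext => x; rewrite !mul1r.
(* Besides [e1] and [e2], the split graph has exactly the edges [Some e] with e different from
   [e0]. *)
rewrite [RHS](reindex_onto (Some : edge G -> edge G') (odflt e0)); last by case.
apply: eq_big => [e|e ne].
  by rewrite eqxx andbT.
rewrite (on_edge_split_other f ne) (on_edge_split_other g ne) (len_some ne).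
exact: erefl.
Qed.

Lemma variogram_split (x1 x2 : gpoint G) :
  variogram m.+1 (phi x1) (phi x2) = variogram m.+1 x1 x2.
Proof.
(* The new vertex, numbered last, adds the value of f at s to the sum over vertices. *)
apply: (transfer_variogram (z := pt e0 s) (b := 1) split_ptK merge_ptK).
- exact: split_smooth.
- exact: split_innerF.
- move=> f; rewrite big_ord_recr /= unlift_none mul1r; congr (_ + _).
  by apply: eq_bigr => v _; rewrite -[widen_ord _ _]/(old v) -lift_old liftK.
Qed.

End SplitEdge.

Lemma variogram_same_mgraph {R : realType} (m : nat) (G G' : mgraph R)
    (phi : gpoint G -> gpoint G') : same_mgraph phi ->
  forall x1 x2, variogram m.+1 (phi x1) (phi x2) = variogram m.+1 x1 x2.
Proof.
elim=> {G G' phi}.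
- by [].
- by move=> G G' phi psi _ IH _ psiK x1 x2; rewrite -IH !psiK.
- by move=> G1 G2 G3 phi psi _ IH1 _ IH2 x1 x2; rewrite /= IH2 IH1.
- exact: variogram_reorder.
- exact: variogram_relabel.
- exact: variogram_reorient.
- exact: variogram_split.
Qed.

Theorem proposition3p3 (R : realType) (p : nat) (hp : (1 <= p)%N)
    (G : mgraph R) :
  [/\ forall (s : 'S_(nv G)) (x1 x2 : gpoint G),
        variogram p (reorder_pt s x1) (reorder_pt s x2) = variogram p x1 x2,
      forall (flip : pred (edge G)) (x1 x2 : gpoint G),
        variogram p (reorient_pt flip x1) (reorient_pt flip x2)
        = variogram p x1 x2,
      forall (e : edge G) (s : R) (hs : 0 < s < len e),
        (forall x1 x2 : gpoint G,
           variogram p (split_pt hs x1) (split_pt hs x2) = variogram p x1 x2) /\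
        (forall y1 y2 : gpoint (split_edge hs),
           variogram p (merge_pt y1) (merge_pt y2) = variogram p y1 y2) &
      forall (G' : mgraph R) (phi : gpoint G -> gpoint G'),
        same_mgraph phi ->
        forall x1 x2 : gpoint G,
          variogram p (phi x1) (phi x2) = variogram p x1 x2 /\
          variogram_dist p (phi x1) (phi x2) = variogram_dist p x1 x2].
Proof.
case: p hp => // m _; split.
- exact: variogram_reorder.
- exact: variogram_reorient.
- move=> e s hs; split; first exact: variogram_split.
  by move=> y1 y2; rewrite -(variogram_split m hs) !merge_ptK.
- move=> G' phi same x1 x2.
  by rewrite /variogram_dist (variogram_same_mgraph m same).
Qed.
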